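(* For any $h\in H$ and any $x\in\sum_{v\in\mathcal{V}}(\delta_v-2)E_v^*+\operatorname{int}(\mathcal{S}')$ we have $$Q_h(x)=\sum_{v\in\mathcal{V}}\mathrm{Coeff}\Big(\mathrm{T}\Big[t_v^{-r_{h-[x]}}f_h(t_v)\frac{t_v}{1-t_v}\Big],t_v^{x}\Big)-\sum_{\overline{vw}\text{ edge of }\mathcal{T}}\mathrm{Coeff}\Big(\mathrm{T}\Big[\mathbf{t}_{vw}^{-r_{h-[x]}}f_h(\mathbf{t}_{vw})\frac{t_vt_w}{(1-t_v)(1-t_w)}\Big],\mathbf{t}_{vw}^{x}\Big).$$
   Context: $\mathcal{T}$ is a finite tree (a connected negative definite plumbing graph with all genera zero) with vertex set $\mathcal{V}$; $\delta_v$ is the valency of $v$. $L=\mathbb{Z}\langle E_v\rangle_{v\in\mathcal{V}}$ is a free lattice with a negative definite integral symmetric form $(\,,\,)$ such that, for $v\ne w$, $(E_v,E_w)=1$ if $\overline{vw}$ is an edge and $0$ otherwise. $L'\subset L\otimes\mathbb{Q}$ is the dual lattice, freely generated by the elements $E_v^*$ defined by $(E_v^*,E_w)=-1$ if $v=w$ and $0$ otherwise (all coordinates of $E_v^*$ in the basis $\{E_w\}$ are positive). $H=L'/L$ is a finite group (written additively in $h-[x]$); $[x]\in H$ is the class of $x\in L'$. For $g\in H$, $r_g$ is the unique element of $L'\cap\sum_{v}[0,1)E_v$ with $[r_g]=g$. $\mathcal{S}'=\mathbb{Z}_{\ge0}\langle E_v^*\rangle_{v}$ and $\operatorname{int}(\mathcal{S}')=\mathbb{Z}_{>0}\langle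 E_v^*\rangle_{v}$ (the elements of $\mathcal{S}'$ in the interior of the real cone $\mathbb{R}_{\ge0}\langle E_v^*\rangle_v$). For $y=\sum_v y_vE_v\in L'$ and $\emptyset\ne\mathcal{I}\subseteq\mathcal{V}$ put $\mathbf{t}^y=\prod_{v\in\mathcal V} t_v^{y_v}$, $\mathbf{t}_{\mathcal{I}}^{y}=\prod_{v\in\mathcal{I}}t_v^{y_v}$; for $\mathcal{I}=\{v\}$ write $t_v^{y}=t_v^{y_v}$, and for $\mathcal{I}=\{v,w\}$ write $\mathbf{t}_{vw}=\mathbf{t}_{\{v,w\}}$. Define $f_h$ by $f_H(\mathbf{t})=\prod_{v\in\mathcal{V}}(1-[E_v^*]\mathbf{t}^{E_v^*})^{\delta_v-2}=\sum_{h\in H}f_h(\mathbf{t})\cdot h$ (coefficients in $\mathbb{Z}[H]$, each $f_h$ a rational function), and let $f_h(\mathbf{t}_{\mathcal{I}})$ be $f_h(\mathbf{t})$ with $t_v=1$ for $v\notin\mathcal{I}$. If $\sum_{l'}p_{l'}\mathbf{t}^{l'}$ is the Taylor expansion at the origin of $\prod_v(1-\mathbf{t}^{E_v^*})^{\delta_v-2}$, then the Taylor expansion of $f_h(\mathbf{t}_{\mathcal{I}})$ is $\sum_{[l']=h}p_{l'}\mathbf{t}_{\mathcal{I}}^{l'}$. $\mathrm{T}[\,\cdot\,]$ is Taylor expansion at the origin (a monomial prefactor with possibly negative exponents just shifts the series), and $\mathrm{Coeff}(S,\mathbf{t}_{\mathcal{I}}^{x})$ is the coefficient of $\mathbf{t}_{\mathcal{I}}^x$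 in $S$. Write $l'\ge x$ if all coordinates of $l'-x$ in the basis $\{E_v\}$ are $\ge0$. For $h\in H$ the counting function is $Q_h(x)=\sum_{l'\not\ge x,\,[l']=h}p_{l'}$ (a finite sum), $x\in L'$. *)

(* Defs.v *)
From HB Require Import structures.
From mathcomp Require Import all_boot all_order all_algebra.
From mathcomp Require Import ring_quotient.
From mathcomp Require Import finmap monalg.
From mathcomp Require Import boolp classical_sets fsbigop.

Set Implicit Arguments.
Unset Strict Implicit.
Unset Printing Implicit Defensive.

Import Order.TTheory GRing.Theory Num.Theory.
Local Open Scope ring_scope.

(* The group ring Z[A] of an additive group A.  The library's product on malg
   excludes monoids with nontrivial units, hence the alias with its own ring
   structure. The monomial attached to a : A is written t^[a]. *)

Definition gring (A : zmodType) := {malg int[A]}.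
HB.instance Definition _ (A : zmodType) := GRing.Zmodule.on (gring A).

Definition gmon (A : zmodType) (a : A) : gring A := << 1 *g a >>.
Notation "t^[ a ]" := (gmon a) (format "t^[ a ]") : ring_scope.

Section GroupRing.
Variable A : zmodType.
Implicit Types f g : {malg int[A]}.

Definition gmul f g : {malg int[A]} :=
  \sum_(a <- msupp f) \sum_(b <- msupp g) << f@_a * g@_b *g a + b >>.

Let gmulw (d1 d2 : {fset A}) f g :
  (msupp f `<=` d1)%fset -> (msupp g `<=` d2)%fset ->
  gmul f g = \sum_(a <- d1) \sum_(b <- d2) << f@_a * g@_b *g a + b >>.
Proof.
move=> le_d1 le_d2; rewrite /gmul (big_fset_incl _ le_d1) /=.
  apply/eq_bigr=> a _; apply/big_fset_incl => // b _ /mcoeff_outdom ->.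
  by rewrite mulr0 monalgU0.
move=> a _ /mcoeff_outdom fa.
by rewrite big1 // => b _; rewrite fa mul0r monalgU0.
Qed.

Let gmulC f g : gmul f g = gmul g f.
Proof.
rewrite /gmul exchange_big; apply: eq_bigr => a _; apply: eq_bigr => b _.
by rewrite mulrC addrC.
Qed.

Let gmul0 g : gmul 0 g = 0.
Proof. by rewrite /gmul msupp0 big_seq_fset0. Qed.

Let gmulDl f1 f2 g : gmul (f1 + f2) g = gmul f1 g + gmul f2 g.
Proof.
rewrite (gmulw (msuppD_le f1 f2) (fsubset_refl _)).
rewrite (gmulw (fsubsetUl _ (msupp f2)) (fsubset_refl _)).
rewrite (gmulw (fsubsetUr (msupp f1) _) (fsubset_refl _)).
rewrite -big_split /=; apply/eq_bigr=> a _.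
rewrite -big_split /=; apply/eq_bigr=> b _.
by rewrite mcoeffD mulrDl monalgUD.
Qed.

Let gmulUU c1 c2 a b :
  gmul << c1 *g a >> << c2 *g b >> = << c1 * c2 *g a + b >>.
Proof. by rewrite (gmulw msuppU_le msuppU_le) !big_seq_fset1 !mcoeffUU. Qed.

Let gmul1 g : gmul << 1 *g 0 >> g = g.
Proof.
rewrite (gmulw msuppU_le (fsubset_refl _)) big_seq_fset1 [RHS]monalgE.
by apply: eq_bigr => b _; rewrite mcoeffUU mul1r add0r.
Qed.

Let gmul_suml (s : {fset A}) (F : A -> {malg int[A]}) g :
  gmul (\sum_(a <- s) F a) g = \sum_(a <- s) gmul (F a) g.
Proof. by apply: (big_morph (gmul^~ g) (fun _ _ => gmulDl _ _ _) (gmul0 g)). Qed.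

Let gmul_sumr (s : {fset A}) (F : A -> {malg int[A]}) g :
  gmul g (\sum_(a <- s) F a) = \sum_(a <- s) gmul g (F a).
Proof. by rewrite gmulC gmul_suml; apply: eq_bigr => a _; rewrite gmulC. Qed.

Let gmulA : associative gmul.
Proof.
move=> f g h; rewrite (monalgE f) (monalgE g) (monalgE h).
rewrite !gmul_suml; apply: eq_bigr => a _.
rewrite gmul_sumr [gmul _ (\sum_(b <- msupp g) _)]gmul_sumr gmul_suml.
apply: eq_bigr => b _.
rewrite !gmul_sumr; apply: eq_bigr => c _.
by rewrite !gmulUU mulrA addrA.
Qed.

Let gone_neq0 : << 1 *g 0 >> != 0 :> {malg int[A]}.
Proof. by rewrite monalgU_eq0. Qed.

HB.instance Definition _ := GRing.Zmodule_isComNzRing.Build (gring A)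
  gmulA gmulC gmul1 gmulDl gone_neq0.

End GroupRing.

Definition gmap (A B : zmodType) (phi : A -> B) (f : gring A) : gring B :=
  \sum_(a <- msupp f) << f@_a *g phi a >>.

(* Formal fractions in Z[A]. *)

Record gfrac (A : zmodType) := GFrac { num : gring A; den : gring A }.

Definition gfrac_eq A (f g : gfrac A) := num f * den g = num g * den f.
Definition gfrac_one A : gfrac A := GFrac 1 1.
Definition gfrac_mul A (f g : gfrac A) :=
  GFrac (num f * num g) (den f * den g).
Definition gfrac_map (A B : zmodType) (phi : A -> B) (f : gfrac A) :=
  GFrac (gmap phi (num f)) (gmap phi (den f)).

Definition gfrac_exp A (a : gring A) (k : int) : gfrac A :=
  match k with
  | Posz n => GFrac (a ^+ n) 1
  | Negz n => GFrac 1 (a ^+ n.+1)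
  end.

(* L (x) Q, in coordinates with respect to the basis (E_v). An element y is also
   the exponent of the monomial prod_v t_v ^ (y v); thus gring (QL V) is the
   ring of Laurent polynomials in the t_v with rational exponents. *)

Notation QL V := {ffun V -> rat}.

Section Exponents.
Variable V : finType.

Definition Evec (v : V) : QL V := [ffun w => (v == w)%:R].

Definition inL : {pred QL V} := fun y => [forall v, y v \is a Num.int].

(* The exponent of t_I^y, i.e., of t^y with t_v = 1 for v outside I. *)
Definition restr (I : {set V}) (y : QL V) : QL V :=
  [ffun v => if v \in I then y v else 0].

Definition subst (I : {set V}) : gfrac (QL V) -> gfrac (QL V) :=
  gfrac_map (restr I).

Definition series := QL V -> int.

Definition Coeff (S : series) (y : QL V) : int := S y.

(* Laurent-Puiseux series in the t_v: exponents with a common denominator,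
   bounded below. *)
Definition puiseux (S : series) :=
  exists (m : nat) (y0 : QL V), (0 < m)%N /\
    forall y, S y != 0 -> y *+ m \in inL /\ forall v, y0 v <= y v.

Definition poly_act (D : gring (QL V)) (S : series) : series :=
  fun y => \sum_(z <- msupp D) D@_z * S (y - z).

(* S is the expansion of f: the Laurent-Puiseux series with den f * S = num f.
   It exists and is unique when den f is 1 plus a combination of monomials with
   nonzero nonnegative exponents. *)
Definition is_taylor (f : gfrac (QL V)) (S : series) :=
  puiseux S /\ poly_act (den f) S = (fun y => (num f)@_y).

Definition Taylor (f : gfrac (QL V)) : series :=
  xget (fun=> 0) [set S | is_taylor f S]%classic.

End Exponents.

Arguments inL {V}.

Section Form.
Variables (V : finType) (adj : rel V) (selfint : V -> int).

Definition gram (v w : V) : int :=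
  if v == w then selfint v else (adj v w)%:Z.

Definition form (x y : QL V) : rat :=
  \sum_v \sum_w x v * (gram v w)%:~R * y w.

End Form.

Record plumbing_tree (V : finType) := PlumbingTree {
  adj : rel V;
  selfint : V -> int;
  vertex_nonempty : (0 < #|V|)%N;
  adj_sym : symmetric adj;
  adj_irr : irreflexive adj;
  adj_connected : forall v w, connect adj v w;
  adj_acyclic : forall c : seq V, (2 < size c)%N -> ~ ucycle adj c;
  form_negdef : forall l : QL V, l \in inL -> l != 0 ->
    form adj selfint l l < 0
}.

Section Lattice.
Variables (V : finType) (G : plumbing_tree V).

Local Notation "'( x , y )" := (form (adj G) (selfint G) x y)
  (at level 8, format "''(' x ,  y )").

Definition valency (v : V) : nat := #|[set w | adj G v w]|.

Definition edges : {set {set V}} :=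
  [set I | [exists v, exists w, adj G v w && (I == [set v; w])]].

Lemma formDl x y z : '(x + y, z) = '(x, z) + '(y, z).
Proof.
rewrite /form -big_split; apply: eq_bigr => v _ /=.
by rewrite -big_split; apply: eq_bigr => w _; rewrite ffunE !mulrDl.
Qed.

Lemma formNl x y : '(- x, y) = - '(x, y).
Proof.
rewrite /form -sumrN; apply: eq_bigr => v _ /=.
by rewrite -sumrN; apply: eq_bigr => w _; rewrite ffunE !mulNr.
Qed.

Definition in_dual : {pred QL V} := fun y => [forall w, '(y, Evec w) \is a Num.int].

Fact in_dual_zmod : zmod_closed in_dual.
Proof.
split=> [|x y /forallP xD /forallP yD]; apply/forallP => w.
  by rewrite /form big1 // => v _; rewrite big1 // => u _; rewrite ffunE !mul0r.
by rewrite formDl formNl rpredB.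
Qed.
HB.instance Definition _ := GRing.isZmodClosed.Build (QL V) in_dual in_dual_zmod.

(* L' *)
Record dual := Dual { dual_val :> QL V; _ : dual_val \in in_dual }.
HB.instance Definition _ := [isSub for dual_val].
HB.instance Definition _ := [Choice of dual by <:].
HB.instance Definition _ := [SubChoice_isSubZmodule of dual by <:].

Definition dual_inL : {pred dual} := fun y => val y \in inL.

Fact dual_inL_zmod : zmod_closed dual_inL.
Proof.
split=> [|x y /forallP xL /forallP yL]; apply/forallP => v.
  by rewrite raddf0 ffunE.
by rewrite raddfB !ffunE rpredB.
Qed.
HB.instance Definition _ := GRing.isZmodClosed.Build dual dual_inL dual_inL_zmod.

(* H = L'/L *)
Definition discr : zmodType := Quotient.quot dual_inL.
Definition cls (y : dual) : discr := \pi_(discr)%qT y.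

Definition Estar (v : V) : dual :=
  xget 0 [set y : dual | forall w, '(y, Evec w) = - (v == w)%:R]%classic.

Definition r_ (g : discr) : dual :=
  xget 0 [set y : dual | cls y = g /\ forall v, 0 <= y v < 1]%classic.

Definition fH : gfrac (discr * QL V)%type :=
  \big[@gfrac_mul _/@gfrac_one _]_(v : V)
    gfrac_exp (1 - t^[(cls (Estar v), val (Estar v))]) ((valency v)%:Z - 2).

Definition zeta : gfrac (QL V) :=
  \big[@gfrac_mul _/@gfrac_one _]_(v : V)
    gfrac_exp (1 - t^[val (Estar v)]) ((valency v)%:Z - 2).

Definition p_ (l : dual) : int := Coeff (Taylor zeta) (val l).

(* The coefficient, in Z[L (x) Q], of h in an element of Z[H][L (x) Q]. *)
Definition hcomp (F : gring (discr * QL V)%type) (h : discr) : gring (QL V) :=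
  \sum_(k <- msupp F | k.1 == h) << F@_k *g k.2 >>.

(* Denominators in which any t_v (but not all of them) may be set to 1. *)
Definition good_den (D : gring (QL V)) :=
  D@_0 = 1 /\ forall y, y \in msupp D -> y != 0 -> forall v, 0 < y v.

(* f_H = sum_h (f h) h, where the f h are written over a common denominator. *)
Definition components (f : discr -> gfrac (QL V)) :=
  exists (F : gring (discr * QL V)%type) (D : gring (QL V)),
    [/\ good_den D,
        gfrac_eq fH (GFrac F (gmap (fun y => (0 : discr, y)) D)) &
        forall h, f h = GFrac (hcomp F h) D].

Definition Q_ (h : discr) (x : dual) : int :=
  \sum_(l \in [set l : dual | ~ (forall v, x v <= l v) /\ cls l = h]%classic)
    p_ l.

(* x lies in sum_v (delta_v - 2) E_v^* + int(S'). *)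
Definition in_shifted_interior (x : dual) :=
  exists a : V -> nat, (forall v, 0 < a v)%N /\
    x = \sum_v Estar v *~ ((valency v)%:Z - 2)
        + \sum_v Estar v *+ a v.

(* t_I^{-r} * f(t_I) * prod_(v in I) t_v / (1 - t_v) *)
Definition twisted (I : {set V}) (r : dual) (f : gfrac (QL V)) : gfrac (QL V) :=
  gfrac_mul (gfrac_mul (GFrac t^[restr I (- val r)] 1) (subst I f))
    (\big[@gfrac_mul _/@gfrac_one _]_(v in I) GFrac t^[Evec v] (1 - t^[Evec v])).

End Lattice.

(* Main.v *)
From HB Require Import structures.
From mathcomp Require Import all_boot all_order all_algebra.
From mathcomp Require Import finmap monalg.
From mathcomp Require Import boolp classical_sets fsbigop.
From mathcomp Require Import ring lra zify.
Require Import Defs.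

Set Implicit Arguments.
Unset Strict Implicit.
Unset Printing Implicit Defensive.

Import Order.TTheory GRing.Theory Num.Theory.
Local Open Scope ring_scope.

(** Write p for the Taylor coefficients of the product of the (1 - t^(E*_v))^(delta_v - 2).
    A function phi on exponents is paired with f_H by summing p_l phi(l).  For an exponent
    l let I(l) be the set of the v with l_v < x_v.  The twist by r_(h-[x]) makes all
    exponents that matter integral, and turns strict inequalities into the extraction of
    one coefficient of a product of t_v/(1-t_v): the term of v (of an edge vw) in the
    theorem is the sum of the p_l with [l] = h and v in I(l) (and v, w in I(l));
    see [Coeff_twisted_low_sum].  The counting function is the sum of the p_l with [l] = h
    and I(l) nonempty; see [Q_E].

    So the theorem says that #vertices - #edges of the forest spanned by I(l), that is its
    number of components, may be replaced by 1 (by 0 if I(l) is empty) once summed against p.  Growing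
    a subtree one leaf at a time ([low_sum_vertices_edges]), this follows from: if a vertex u
    outside a set A separates two elements of A, then the sum of the p_l with [l] = h, A
    inside I(l) and u outside I(l) is zero ([low_sum_sep]).

    To prove this, let phi be the indicator function of these l.
    - It is invariant under translation by E_y for y outside A and u.  Modulo such
      translations, the factor of f_H attached to a branch of the tree that avoids A and u
      becomes a Laurent polynomial after multiplication by the factor 1 - t^(E*_v), v being either
      end of the edge that carries the branch ([Pres_branch]).  Since u separates elements of A,
      there are enough spare factors: f_H times the factors at A is a Laurent polynomial as
      far as its action on phi is concerned ([Pres_kapA]).
    - Write l = x - sum c_v E*_v.  By the minimum principle for negative definite forms,
      phi(l) = 0 as soon as c_v > 0 for all v outside A.  As the action on phi is polynomial,
      the result of applying f_H to phi vanishes as soon as c_v > delta_v - 2 for v outside A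
      ([pairing_eq0]).  The hypothesis on x puts the exponent l = 0 in that region.

    Rather than multiplying power series, the group ring is made to act on functions of the
    exponents by translations; the denominators 1 - t^(E*_v) are invertible on functions
    that vanish at all large exponents, because E*_v has positive coordinates.  The Taylor
    expansions of the statement are identified with pairings by the uniqueness of
    expansions ([Taylor_unique]). *)

(** * The group ring and its action on functions *)

Section GroupRingAction.
Variable A : zmodType.
Implicit Types (D E : gring A) (f g : A -> int) (a b : A).

(** The integral of [f] against [D], seen as a finitely supported measure. *)
Definition lin D f : int := \sum_(a <- msupp D) D@_a * f a.

Lemma linw (d : {fset A}) D f : (msupp D `<=` d)%fset ->
  lin D f = \sum_(a <- d) D@_a * f a.
Proof.
move=> le_d; rewrite /lin (big_fset_incl _ le_d) //= => a _ /mcoeff_outdom ->.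
by rewrite mul0r.
Qed.

Lemma eq_lin D f g : (forall a, f a = g a) -> lin D f = lin D g.
Proof. by move=> fg; apply: eq_bigr => a _; rewrite fg. Qed.

Lemma linDl D E f : lin (D + E) f = lin D f + lin E f.
Proof.
rewrite (linw _ (msuppD_le D E)) (linw _ (fsubsetUl (msupp D) (msupp E))).
rewrite (linw _ (fsubsetUr (msupp D) (msupp E))) -big_split /=.
by apply: eq_bigr => a _; rewrite mcoeffD mulrDl.
Qed.

Lemma linU c a f : lin << c *g a >> f = c * f a.
Proof. by rewrite (linw _ msuppU_le) big_seq_fset1 mcoeffUU. Qed.

Lemma lin_mon a f : lin t^[a] f = f a.
Proof. by rewrite linU mul1r. Qed.

Lemma lin0l f : lin 0 f = 0.
Proof. by rewrite /lin msupp0 big_seq_fset0. Qed.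

Lemma linNl D f : lin (- D) f = - lin D f.
Proof. by apply/eqP; rewrite -addr_eq0 -linDl addNr lin0l. Qed.

Lemma linBl D E f : lin (D - E) f = lin D f - lin E f.
Proof. by rewrite linDl linNl. Qed.

Lemma linDr D f g : lin D (fun a => f a + g a) = lin D f + lin D g.
Proof. by rewrite -big_split; apply: eq_bigr => a _; rewrite mulrDr. Qed.

Lemma linBr D f g : lin D (fun a => f a - g a) = lin D f - lin D g.
Proof. by rewrite -sumrB; apply: eq_bigr => a _; rewrite mulrBr. Qed.

Lemma lin0r D : lin D (fun=> 0) = 0.
Proof. by rewrite /lin big1 // => a _; rewrite mulr0. Qed.

Lemma lin_suml I (r : seq I) (F : I -> gring A) f :
  lin (\sum_(i <- r) F i) f = \sum_(i <- r) lin (F i) f.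
Proof. by apply: (big_morph (lin^~ f) (fun _ _ => linDl _ _ _) (lin0l f)). Qed.

Lemma lin_sumr I (r : seq I) D (F : I -> A -> int) :
  lin D (fun a => \sum_(i <- r) F i a) = \sum_(i <- r) lin D (F i).
Proof.
elim: r => [|i r IH]; first by under eq_lin do rewrite big_nil; rewrite lin0r big_nil.
by under eq_lin do rewrite big_cons; rewrite linDr IH big_cons.
Qed.

Lemma gmulE D E : D * E = gmul D E. Proof. by []. Qed.

Lemma linM D E f : lin (D * E) f = lin D (fun a => lin E (fun b => f (a + b))).
Proof.
rewrite gmulE /gmul lin_suml; apply: eq_bigr => a _.
rewrite lin_suml mulr_sumr; apply: eq_bigr => b _.
by rewrite linU mulrA.
Qed.

Lemma lin1 f : lin 1 f = f 0.
Proof. exact: lin_mon. Qed.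

Lemma lin_coef D b : lin D (fun a => (a == b)%:R) = D@_b.
Proof.
rewrite {2}(monalgE D) raddf_sum; apply: eq_bigr => a _ /=.
by rewrite mcoeffU mulr_natr.
Qed.

Lemma gring_eqP D E : (forall f, lin D f = lin E f) -> D = E.
Proof. by move=> DE; apply/malgP => b; rewrite -!lin_coef. Qed.

Lemma gmonD a b : t^[a + b] = t^[a] * t^[b] :> gring A.
Proof. by apply: gring_eqP => f; rewrite linM !lin_mon. Qed.

(** The transposed action of the group ring on functions: t^[a] translates
    the argument by [a]. *)
Definition tact D f : A -> int := fun b => lin D (fun a => f (b + a)).

Lemma tactM D E f : tact (D * E) f = tact D (tact E f).
Proof.
apply/funext => b; rewrite /tact linM; apply: eq_lin => a.
by apply: eq_lin => c; rewrite addrA.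
Qed.

Lemma tactC D E f : tact D (tact E f) = tact E (tact D f).
Proof. by rewrite -!tactM mulrC. Qed.

Lemma tact1 f : tact 1 f = f.
Proof. by apply/funext => b; rewrite /tact lin1 addr0. Qed.

Lemma tact_mon a f : tact t^[a] f = (fun b => f (b + a)).
Proof. by apply/funext => b; rewrite /tact lin_mon. Qed.

Lemma tact_Bmon a f b : tact (1 - t^[a]) f b = f b - f (b + a).
Proof. by rewrite /tact linBl lin1 lin_mon addr0. Qed.

Lemma tactDr D f g : tact D (fun b => f b + g b) = (fun b => tact D f b + tact D g b).
Proof. by apply/funext => b; rewrite /tact linDr. Qed.

Lemma tactBr D f g : tact D (fun b => f b - g b) = (fun b => tact D f b - tact D g b).
Proof. by apply/funext => b; rewrite /tact linBr. Qed.

End GroupRingAction.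

Lemma lin_exchange (A B : zmodType) (D : gring A) (E : gring B) (f : A -> B -> int) :
  lin D (fun a => lin E (f a)) = lin E (fun b => lin D (f^~ b)).
Proof.
rewrite {2}/lin lin_sumr; apply: eq_bigr => b _.
by rewrite /lin mulr_sumr; apply: eq_bigr => a _; rewrite mulrCA.
Qed.

Lemma lin_gmap (A B : zmodType) (phi : A -> B) (D : gring A) f :
  lin (gmap phi D) f = lin D (f \o phi).
Proof. by rewrite /gmap lin_suml; apply: eq_bigr => a _; rewrite linU. Qed.

Lemma gmapM (A B : zmodType) (phi : {additive A -> B}) (D E : gring A) :
  gmap phi (D * E) = gmap phi D * gmap phi E.
Proof.
apply: gring_eqP => f; rewrite linM !lin_gmap linM; apply: eq_lin => a /=.
by rewrite lin_gmap; apply: eq_lin => b /=; rewrite raddfD.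
Qed.

Lemma lin_hcomp V (G : plumbing_tree V) (F : gring (discr G * QL V)%type) h f :
  lin (hcomp F h) f = lin F (fun k => (k.1 == h)%:R * f k.2).
Proof.
rewrite /hcomp big_mkcond lin_suml; apply: eq_bigr => k _.
by case: eqP => _; rewrite ?lin0l ?mul0r ?mulr0 // linU mul1r.
Qed.

(** * Branches of a tree *)

Section Branches.
Variables (V : finType) (G : plumbing_tree V).
Implicit Types (u v w x y : V).

Local Notation adj := (adj G).

(** Adjacency in the tree minus [v]. *)
Definition avoid v : rel V := [rel x y | [&& adj x y, x != v & y != v]].

(** The vertex set of the component of the tree minus [v] containing [w]. *)
Definition branch v w : {set V} := [set x | (w != v) && connect (avoid v) w x].

Lemma adj_neq v w : adj v w -> v != w.
Proof. by apply: contraTneq => ->; rewrite adj_irr. Qed.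

Lemma avoid_connectC v x y : connect (avoid v) x y = connect (avoid v) y x.
Proof.
apply: sym_connect_sym => a b; rewrite /avoid /= (adj_sym G).
by rewrite [(a != v) && _]andbC.
Qed.

Lemma avoid_path v x p : x != v -> path (avoid v) x p = path adj x p && (v \notin p).
Proof.
elim: p x => [|y p IH] x xv //=; rewrite inE negb_or [v == y]eq_sym.
have -> : avoid v x y = adj x y && (y != v) by rewrite /avoid /= xv.
by case: (eqVneq y v) => [->|yv] /=; rewrite ?andbF // IH // andbT andbA.
Qed.

Lemma avoid_connect_neq v x y : x != v -> connect (avoid v) x y -> y != v.
Proof.
move=> xv /connectP[p]; rewrite avoid_path // => /andP[_ vp] ->.
have := mem_last x p; rewrite inE => /predU1P[-> //|yp].
by apply: contraNneq vp => <-.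
Qed.

Lemma branch_self v w : w != v -> w \in branch v w.
Proof. by move=> wv; rewrite inE wv connect0. Qed.

Lemma branch_root v w : v \notin branch v w.
Proof.
rewrite inE; apply/negP => /andP[wv /(avoid_connect_neq wv)].
by rewrite eqxx.
Qed.

(** Two neighbours of [v] joined by a path avoiding [v] would close a cycle. *)
Lemma branch_inj v w w' x : adj v w -> adj v w' ->
  x \in branch v w -> x \in branch v w' -> w = w'.
Proof.
move=> vw vw'; rewrite !inE => /andP[wv c] /andP[wv' c'].
have {c c'} : connect (avoid v) w w' by apply: connect_trans c _; rewrite avoid_connectC.
case/connectP => p0 /shortenP[p + Up _ lp] {p0}.
rewrite avoid_path // => /andP[pp vp].
case: p pp vp Up lp => [//|a p] pp vp Up lp.
case: (@adj_acyclic V G [:: v, w, a & p]) => //; apply/andP; split.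
  rewrite /= rcons_path; move: pp => /= /andP[-> ->].
  by rewrite vw /= -[last a p]/(last w (a :: p)) -lp (adj_sym G).
move: Up; rewrite !cons_uniq => ->; rewrite andbT inE negb_or eq_sym wv.
exact: vp.
Qed.

Lemma branch_cover v x : x != v -> exists2 w, adj v w & x \in branch v w.
Proof.
move=> xv; have /connectP[p0 /shortenP[p pp Up _] lp] := adj_connected G v x.
case: p pp Up lp => [|w p] /=; first by move=> _ _ xE; rewrite xE eqxx in xv.
move=> /andP[vw pp] /andP[vp _] lp; exists w => //.
move: vp; rewrite inE negb_or eq_sym => /andP[wv vp].
by rewrite inE wv; apply/connectP; exists p; rewrite // avoid_path // pp.
Qed.

(** Removing an edge leaves two components. *)
Lemma branchC u v : adj u v -> branch u v = ~: branch v u.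
Proof.
move=> uv; have vu : adj v u by rewrite adj_sym.
have nuv : u != v := adj_neq uv; have nvu : v != u by rewrite eq_sym.
apply/setP => x; rewrite [RHS]inE; apply/idP/idP => [xu|xv].
  have xNu : x != u by apply: contraTneq xu => ->; apply: branch_root.
  apply/negP => xv; case: (eqVneq x v) xv xu => [->|xNv xv].
    by move=> xv; have := branch_root v u; rewrite xv.
  rewrite inE nvu => /connectP[p0 /shortenP[p pp Up _] lp] {p0}.
  case: p pp Up lp => [|w p] pp Up lp; first by rewrite lp eqxx in xNv.
  move: pp; rewrite avoid_path // inE negb_or => /andP[/= /andP[vw pp] /andP[uw up]].
  move: Up; rewrite cons_uniq inE negb_or => /andP[/andP[vNw vp] _].
  have /(branch_inj vw vu)/(_ xv) E : x \in branch v w.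
    rewrite inE eq_sym vNw; apply/connectP; exists p => //.
    by rewrite avoid_path ?pp // eq_sym.
  by rewrite E eqxx in uw.
have xNu : x != u by apply: contraNneq xv => ->; apply: branch_self.
case: (branch_cover xNu) => w uw xw.
case: (eqVneq w v) xw uw => [->//|wv xw uw]; case/negP: xv.
move: xw; rewrite !inE nuv => /andP[wu /connectP[p pp lp]].
apply/connectP; exists (w :: p); rewrite // avoid_path //= uw /=.
rewrite inE negb_or eq_sym wv /=.
move: (pp); rewrite avoid_path // => /andP[-> up] /=.
apply: contraNN wv => vp; apply/eqP; apply: (branch_inj uw uv (x := v)).
  by rewrite inE wu; apply: (path_connect pp); rewrite inE vp orbT.
exact: branch_self.
Qed.

Lemma branch_sub_eq v w x : adj v w -> x \in branch v w ->
  forall y, adj v y -> (x \in branch v y) = (y == w).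
Proof.
move=> vw xw y vy; apply/idP/eqP => [xy|-> //].
exact: branch_inj xy xw.
Qed.

(** Below its root [v], the branch at [u] splits into the branches at [v] towards
    the neighbours of [v] other than [u]. *)
Lemma branch_split u v x : adj u v -> x != v ->
  (x \in branch u v) = [exists w, [&& adj v w, w != u & x \in branch v w]].
Proof.
move=> uv xv; have vu : adj v u by rewrite adj_sym.
rewrite branchC // inE; case: (branch_cover xv) => w vw xw.
rewrite (branch_sub_eq vw xw) // eq_sym.
apply/idP/existsP => [wu|[y /and3P[vy yu xy]]]; first by exists w; rewrite vw wu.
by rewrite -(branch_inj vy vw xy xw).
Qed.

Lemma branch_sub u v w : adj u v -> adj v w -> w != u ->
  branch v w \subset branch u v.
Proof.
move=> uv vw wu; apply/fintype.subsetP => x xw.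
rewrite branch_split //; first by apply/existsP; exists w; rewrite vw wu.
by apply: contraTneq xw => ->; apply: branch_root.
Qed.

Lemma branch_proper u v w : adj u v -> adj v w -> w != u ->
  (#|branch v w| < #|branch u v|)%N.
Proof.
move=> uv vw wu; apply: proper_card; apply/properP; split.
  exact: branch_sub.
by exists v; [rewrite branch_self // eq_sym (adj_neq uv)|apply: branch_root].
Qed.

End Branches.

(** * The lattice and its dual *)

Section DualLattice.
Variables (V : finType) (G : plumbing_tree V).
Implicit Types (u v w : V) (x y z : QL V).

Local Notation adj := (adj G).
Local Notation frm := (form adj (selfint G)).

Lemma gramC v w : gram adj (selfint G) v w = gram adj (selfint G) w v.
Proof. by rewrite /gram eq_sym (adj_sym G); case: eqP => // ->. Qed.

Lemma formC x y : frm x y = frm y x.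
Proof.
rewrite /form exchange_big; apply: eq_bigr => w _; apply: eq_bigr => v _ /=.
by rewrite gramC; ring.
Qed.

Lemma form0l y : frm 0 y = 0.
Proof. by rewrite -[0](subrr (0 : QL V)) formDl formNl subrr. Qed.

Lemma formBl x y z : frm (x - y) z = frm x z - frm y z.
Proof. by rewrite formDl formNl. Qed.

Lemma formMnl x y n : frm (x *+ n) y = frm x y *+ n.
Proof. by elim: n => [|n IH]; rewrite ?form0l // !mulrS formDl IH. Qed.

Lemma formMzl x y (n : int) : frm (x *~ n) y = frm x y *~ n.
Proof. by case: n => n; rewrite ?NegzE ?mulrNz -?pmulrn ?formNl formMnl. Qed.

Lemma form_suml (I : finType) (P : pred I) (F : I -> QL V) y :
  frm (\sum_(i | P i) F i) y = \sum_(i | P i) frm (F i) y.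
Proof. by apply: (big_morph (frm^~ y) (fun _ _ => formDl _ _ _ _) (form0l y)). Qed.

Lemma form_Evec y w :
  frm y (Evec w) = y w * (selfint G w)%:~R + \sum_(v | adj w v) y v.
Proof.
have E v : \sum_w0 y v * (gram adj (selfint G) v w0)%:~R * Evec w w0 =
           y v * (gram adj (selfint G) v w)%:~R.
  rewrite (bigD1 w) //= ffunE eqxx mulr1 big1 ?addr0 // => i iw.
  by rewrite ffunE eq_sym (negbTE iw) mulr0.
rewrite /form (eq_bigr _ (fun v _ => E v)) (bigD1 w) //= /gram eqxx; congr (_ + _).
rewrite big_mkcond [RHS]big_mkcond; apply: eq_bigr => v _.
case: (eqVneq v w) => [->|vw] /=; first by rewrite adj_irr.
by rewrite (adj_sym G); case: adj; rewrite ?mulr1 ?mulr0.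
Qed.

Lemma form_sum_Evec x y : frm x y = \sum_w y w * frm x (Evec w).
Proof.
rewrite /form exchange_big; apply: eq_bigr => w _ /=.
rewrite mulr_sumr; apply: eq_bigr => v _.
rewrite (bigD1 w) //= ffunE eqxx mulr1 big1 ?addr0 1?mulrC // => i iw.
by rewrite ffunE eq_sym (negbTE iw) mulr0.
Qed.

Lemma common_den (I : finType) (F : I -> rat) :
  exists2 m : nat, (0 < m)%N & forall i, F i *+ m \is a Num.int.
Proof.
exists (\prod_i `|denq (F i)|)%N => [|i].
  by apply: prodn_gt0 => i; rewrite absz_gt0 denq_neq0.
rewrite (bigD1 i) //= mulrnA rpredMn // -mulr_natr.
have -> : (`|denq (F i)|%N)%:R = (denq (F i))%:~R :> rat.
  by rewrite pmulrn gez0_abs // denq_ge0.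
by rewrite -numqE; apply: intr_int.
Qed.

(** The form, given as negative definite on L, is so on L (x) Q. *)
Lemma form_lt0 y : y != 0 -> frm y y < 0.
Proof.
move=> y0; case: (common_den y) => m m0 ym.
have := @form_negdef V G (y *+ m); rewrite formMnl formC formMnl -mulrnA.
rewrite pmulrn_llt0 ?muln_gt0 ?m0 //; apply.
  by apply/forallP => v; rewrite ffunMnE.
apply: contraNneq y0 => /ffunP E; apply/eqP/ffunP => v.
by have /eqP := E v; rewrite ffunMnE ffunE mulrn_eq0 eqn0Ngt m0 => /eqP.
Qed.

(** Minimum principle: a function that is superharmonic wherever it is negative
    is nonnegative. *)
Lemma minimum_principle y :
  (forall v, y v < 0 -> frm y (Evec v) <= 0) -> forall v, 0 <= y v.
Proof.
move=> yneg; pose n : QL V := [ffun v => if y v < 0 then - y v else 0].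
have n_ge0 v : 0 <= n v by rewrite ffunE; case: ifP => // /ltW; rewrite oppr_ge0.
have p_ge0 v : 0 <= (y + n) v.
  by rewrite !ffunE; case: ltP; rewrite ?subrr ?addr0.
have n0 : n = 0.
  apply/eqP; apply: contraT => /form_lt0; rewrite ltNge => /negP[].
  have -> : frm n n = frm (y + n) n - frm y n by rewrite formDl addrC addKr.
  rewrite subr_ge0; apply: (@le_trans _ _ 0).
    rewrite form_sum_Evec; apply: sumr_le0 => v _; rewrite [n v]ffunE.
    case: ifP => [yv|]; last by rewrite mul0r.
    by apply: mulr_ge0_le0; rewrite ?yneg // oppr_ge0 ltW.
  rewrite form_sum_Evec; apply: sumr_ge0 => v _; rewrite form_Evec mulrDr.
  apply: addr_ge0; last by apply: mulr_ge0 => //; apply: sumr_ge0.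
  by rewrite mulrA !ffunE; case: ifP; rewrite ?subrr ?mulr0 ?mul0r.
by move=> v; have := p_ge0 v; rewrite n0 addr0.
Qed.

Lemma form_inj x y : (forall w, frm x (Evec w) = frm y (Evec w)) -> x = y.
Proof.
move=> xy; apply/eqP; rewrite -subr_eq0; apply: contraT => /form_lt0.
by rewrite form_sum_Evec big1 ?ltxx // => w _; rewrite formBl xy subrr mulr0.
Qed.

Lemma Estar_ex v : exists y : dual G, forall w, frm y (Evec w) = - (v == w)%:R.
Proof.
pose f (y : {ffun V -> rat^o}) : {ffun V -> rat^o} := [ffun w => frm y (Evec w)].
have flin : linear f.
  move=> a x y; apply/ffunP => w; rewrite !ffunE formDl; congr (_ + _).
  rewrite !form_Evec ffunE; have -> : \sum_(v | adj w v) (a *: x) v = a * \sum_(v | adj w v) x v.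
    by rewrite mulr_sumr; apply: eq_bigr => i _; rewrite ffunE.
  by rewrite -mulrA -mulrDr.
pose fL := HB.pack_for {linear {ffun V -> rat^o} -> {ffun V -> rat^o}} f
  (GRing.isLinear.Build _ _ _ _ f flin).
have ker0 : lker (linfun fL) == 0%VS.
  apply/lker0P => x y; rewrite !lfunE /= => /ffunP E.
  by apply: form_inj => w; have := E w; rewrite !ffunE.
have : [ffun w => - (v == w)%:R] \in limg (linfun fL).
  by rewrite (lker0_limgf ker0) memvf.
case/memv_imgP => y _; rewrite lfunE /= => /ffunP E.
have yE w : frm y (Evec w) = - (v == w)%:R by have := E w; rewrite !ffunE.
suff yD : (y : QL V) \in in_dual G by exists (Dual yD).
by apply/forallP => w; rewrite yE rpredN; case: eqP.
Qed.

Lemma EstarE v w : frm (Estar G v) (Evec w) = - (v == w)%:R.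
Proof. exact: (xgetPex 0 (Estar_ex v)). Qed.

(** All coordinates of E*_v are positive: it is superharmonic, hence nonnegative, and
    it would vanish at all neighbours of a zero. *)
Lemma Estar_gt0 v w : 0 < Estar G v w.
Proof.
have E_ge0 u : 0 <= Estar G v u.
  by apply: minimum_principle => {}u _; rewrite EstarE oppr_le0; case: eqP.
rewrite lt_def E_ge0 andbT; apply/eqP => Ew0.
suff E0 u : Estar G v u = 0.
  have := EstarE v v; rewrite eqxx form_Evec E0 mul0r add0r.
  rewrite (eq_bigr _ (fun u _ => E0 u)) big1_eq => /eqP.
  by rewrite eq_sym oppr_eq0 oner_eq0.
case/connectP: (adj_connected G w u) => p pp ->.
elim: p w Ew0 pp => [|w' p IH] w //= Ew0 /andP[ww' pp]; apply: IH => //.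
have := EstarE v w; rewrite form_Evec Ew0 mul0r add0r => S.
have : \sum_(u | adj w u) Estar G v u <= 0 by rewrite S oppr_le0; case: eqP.
rewrite (bigD1 w') //= => Sle; apply/eqP; rewrite eq_le E_ge0 andbT.
by apply: le_trans Sle; rewrite lerDl; apply: sumr_ge0.
Qed.

Lemma clsD : {morph @cls V G : x y / x + y}.
Proof. by move=> x y; rewrite /cls raddfD. Qed.

Lemma cls0 : cls (0 : dual G) = 0.
Proof. by rewrite /cls raddf0. Qed.

Lemma clsB : {morph @cls V G : x y / x - y}.
Proof. by move=> x y; rewrite /cls raddfB. Qed.

Lemma cls_eq (x y : dual G) : (cls x == cls y) = (val (x - y) \in inL).
Proof. by rewrite /cls -Quotient.idealrBE. Qed.

End DualLattice.

(** * Fractions of the group ring acting on functions *)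

Lemma prod_exp1 (R : comNzRingType) (I : finType) (F : I -> R) i :
  \prod_j F j ^+ [ffun j => (j == i) : nat] j = F i.
Proof.
rewrite (bigD1 i) //= ffunE eqxx expr1 big1 ?mulr1 // => j /negbTE ji.
by rewrite ffunE ji expr0.
Qed.

Section Operators.
Variables (V : finType) (G : plumbing_tree V).
Implicit Types (u v w : V).

(** Exponents of H-equivariant series: a class of H and a vector of L (x) Q. *)
Notation Gam := (discr G * QL V)%type.
Implicit Types (g : Gam) (phi psi chi : Gam -> int) (D : gring Gam)
  (j k : {ffun V -> int}).

(** The exponent of the monomial [E*_v] t^(E*_v) of f_H. *)
Definition beta v : Gam := (cls (Estar G v), val (Estar G v)).

(** The factor of f_H at [v]. *)
Definition dfac v : gring Gam := 1 - t^[beta v].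

(** Functions vanishing on all exponents with large coordinates. On these, the
    denominators of f_H are invertible. *)
Definition FF phi := exists N : rat, forall g, (forall v, N <= g.2 v) -> phi g = 0.

(** Functions vanishing on all exponents with a very negative [u]-coordinate. *)
Definition CC u phi := exists N : rat, forall g, g.2 u < N -> phi g = 0.

(** Additive subgroups of functions stable under translations; they are stable under
    the group ring. *)
Definition shift_closed (K : (Gam -> int) -> Prop) :=
  [/\ K (fun=> 0), forall phi psi, K phi -> K psi -> K (fun g => phi g - psi g)
    & forall a phi, K phi -> K (fun g => phi (g + a))].

Section ShiftClosed.
Variables (K : (Gam -> int) -> Prop) (Kc : shift_closed K).

Lemma shift_closedB phi psi : K phi -> K psi -> K (fun g => phi g - psi g).
Proof. by case: Kc => _ + _; apply. Qed.

Lemma shift_closedN phi : K phi -> K (fun g => - phi g).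
Proof.
case: Kc => K0 KB _ Kphi; have := KB _ _ K0 Kphi.
by under eq_fun do rewrite sub0r.
Qed.

Lemma shift_closedD phi psi : K phi -> K psi -> K (fun g => phi g + psi g).
Proof.
case: Kc => K0 KB _ Kphi Kpsi; have := KB _ _ Kphi (shift_closedN Kpsi).
by under eq_fun do rewrite opprK.
Qed.

Lemma shift_closedZ (c : int) phi : K phi -> K (fun g => c * phi g).
Proof.
case: Kc => K0 KB _ Kphi; have Kn n : K (fun g => n%:Z * phi g).
  elim: n => [|n IH]; first by under eq_fun do rewrite mul0r.
  by under eq_fun do rewrite -addn1 PoszD mulrDl mul1r; apply: shift_closedD.
case: c => n //; rewrite NegzE; under eq_fun do rewrite mulNr.
exact: shift_closedN.
Qed.

Lemma shift_closed_tact D phi : K phi -> K (tact D phi).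
Proof.
case: Kc => K0 KB Ks Kphi; rewrite /tact /lin.
elim: (msupp D : seq _) => [|a s IH]; first by under eq_fun do rewrite big_nil.
under eq_fun do rewrite big_cons; apply: shift_closedD => //.
exact/shift_closedZ/Ks.
Qed.

End ShiftClosed.

Lemma FF_closed : shift_closed FF.
Proof.
split=> [|phi psi [N phiN] [M psiM]|a phi [N phiN]]; first by exists 0.
  exists (Num.max N M) => g gN; rewrite phiN ?psiM ?subr0 // => v.
    by apply: le_trans (gN v); rewrite le_max lexx orbT.
  by apply: le_trans (gN v); rewrite le_max lexx.
exists (N + \sum_v `|a.2 v|) => g gN; apply: phiN => v; rewrite ffunE.
have := gN v; rewrite (bigD1 v) //=.
have : 0 <= \sum_(i | i != v) `|a.2 i| by apply: sumr_ge0.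
have := ler_norm (- a.2 v); rewrite normrN; lra.
Qed.

Lemma CC_closed u : shift_closed (CC u).
Proof.
split=> [|phi psi [N phiN] [M psiM]|a phi [N phiN]]; first by exists 0.
  exists (Num.min N M) => g; rewrite lt_min => /andP[gN gM].
  by rewrite phiN // psiM // subr0.
by exists (N - a.2 u) => g gN; apply: phiN; rewrite ffunE; lra.
Qed.

Lemma FFB phi psi : FF phi -> FF psi -> FF (fun g => phi g - psi g).
Proof. exact: (shift_closedB FF_closed). Qed.

Lemma FFD phi psi : FF phi -> FF psi -> FF (fun g => phi g + psi g).
Proof. exact: (shift_closedD FF_closed). Qed.

Lemma FF_tact D phi : FF phi -> FF (tact D phi).
Proof. exact: (shift_closed_tact FF_closed). Qed.

Lemma beta_snd v w (n : nat) : (beta v *+ n).2 w = Estar G v w *+ n.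
Proof. by elim: n => [|n IH]; rewrite ?mulr0n ?ffunE // !mulrS -IH /= ffunE. Qed.

Lemma beta_large g v (N : rat) :
  exists M, forall n, (M <= n)%N -> forall w, N <= (g + beta v *+ n).2 w.
Proof.
exists (\max_w Num.bound ((N - g.2 w) / Estar G v w))%N => n Mn w.
rewrite ffunE beta_snd -lerBlDl -mulr_natr -ler_pdivrMl ?Estar_gt0 // mulrC.
apply: le_trans (ler_norm _) _; apply: ltW.
apply: lt_le_trans (archi_boundP (normr_ge0 _)) _.
rewrite ler_nat; apply: leq_trans Mn.
by have := @leq_bigmax _ (fun w => Num.bound ((N - g.2 w) / Estar G v w)) w; rewrite /Num.bound normr_id.
Qed.

Lemma FF_eventually0 phi g v : FF phi ->
  exists M, forall n, (M <= n)%N -> phi (g + beta v *+ n) = 0.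
Proof.
by case=> N phiN; case: (beta_large g v N) => M gM; exists M => n /gM; apply: phiN.
Qed.

Lemma dfac_const (S : Gam -> Prop) v psi :
  (forall g, S g -> S (g + beta v)) -> (forall g, S g -> tact (dfac v) psi g = 0) ->
  forall g (n : nat), S g -> psi g = psi (g + beta v *+ n).
Proof.
move=> Sb psi0 g n Sg; elim: n g Sg => [|n IH] g Sg; first by rewrite addr0.
rewrite mulrS addrA -IH; last exact: Sb.
by apply/eqP; rewrite -subr_eq0 -tact_Bmon psi0.
Qed.

(** If (1 - t^[beta v]) psi vanishes on a set stable under translation by [beta v], so
    does psi: it is constant, and eventually zero, along the translates. *)
Lemma dfac_vanish (S : Gam -> Prop) v psi : FF psi ->
  (forall g, S g -> S (g + beta v)) -> (forall g, S g -> tact (dfac v) psi g = 0) ->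
  forall g, S g -> psi g = 0.
Proof.
move=> Fpsi Sb psi0 g Sg; case: (FF_eventually0 g v Fpsi) => M gM.
by rewrite (dfac_const Sb psi0 M) // gM.
Qed.

(** [D] acts bijectively on [FF]. *)
Definition FF_bij D :=
  (forall phi, FF phi -> exists2 psi, FF psi & tact D psi = phi) /\
  (forall psi, FF psi -> tact D psi = (fun=> 0) -> psi = (fun=> 0)).

Lemma FF_bij1 : FF_bij 1.
Proof.
by split=> [phi Fphi|psi _]; rewrite ?tact1 //; exists phi; rewrite ?tact1.
Qed.

Lemma FF_bijM D E : FF_bij D -> FF_bij E -> FF_bij (D * E).
Proof.
move=> [sD iD] [sE iE]; split=> [phi /sD[psi /sE[chi Fchi <-] <-]|psi Fpsi].
  by exists chi; rewrite ?tactM.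
by rewrite tactM => /iD/(iE _ Fpsi); apply; apply: FF_tact.
Qed.

(** The inverse of [dfac v] is the geometric series, a finite sum at each point. *)
Lemma FF_bij_dfac v : FF_bij (dfac v).
Proof.
split=> [phi Fphi|psi Fpsi psi0]; last first.
  apply/funext => g; apply: (@dfac_vanish (fun=> True) v psi) => //.
  by move=> g' _; rewrite psi0.
have /choice[M MP] g := FF_eventually0 g v Fphi.
pose psi g := \sum_(n < M g) phi (g + beta v *+ n).
have psiE g m : (M g <= m)%N -> psi g = \sum_(n < m) phi (g + beta v *+ n).
  move=> Mm; rewrite /psi -(subnKC Mm) big_split_ord /= [X in _ + X]big1 ?addr0 // => i _.
  by rewrite MP // leq_addr.
exists psi.
  case: Fphi => N phiN; exists N => g gN; rewrite /psi big1 // => n _.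
  apply: phiN => w; apply: le_trans (gN w) _; rewrite ffunE beta_snd lerDl.
  by rewrite mulrn_wge0 // ltW ?Estar_gt0.
apply/funext => g; rewrite tact_Bmon.
pose m := maxn (M g) (M (g + beta v)).
have Mg : (M g <= m.+1)%N by apply: leqW; apply: leq_maxl.
have Mgb : (M (g + beta v)%R <= m)%N by apply: leq_maxr.
rewrite (psiE _ _ Mg) (psiE _ _ Mgb).
rewrite big_ord_recl /= mulr0n addr0 -addrA -sumrB big1 ?addr0 // => i _.
by rewrite /bump /= add1n mulrS addrA subrr.
Qed.

(** The product of the powers (1 - t^[beta v]) ^ m v. *)
Definition dpow (m : {ffun V -> nat}) : gring Gam := \prod_v dfac v ^+ m v.

Lemma dpowD (m n : {ffun V -> nat}) : dpow [ffun v => m v + n v]%N = dpow m * dpow n.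
Proof.
by rewrite /dpow -big_split; apply: eq_bigr => v _; rewrite ffunE exprD.
Qed.

Lemma dpow0 : dpow [ffun=> 0%N] = 1.
Proof. by rewrite /dpow big1 // => v _; rewrite ffunE expr0. Qed.

Lemma dpow_ind (K : gring Gam -> Prop) (m : {ffun V -> nat}) : K 1 ->
  (forall D E, K D -> K E -> K (D * E)) -> (forall v, K (dfac v)) -> K (dpow m).
Proof.
move=> K1 KM Kd; apply: big_ind => // v _.
by elim: (m v) => [|n IH]; rewrite ?expr0 // exprS; apply: KM.
Qed.

Lemma FF_bij_dpow (m : {ffun V -> nat}) : FF_bij (dpow m).
Proof. exact: (dpow_ind m FF_bij1 FF_bijM FF_bij_dfac). Qed.

Lemma dpow_inj (m : {ffun V -> nat}) phi psi : FF phi -> FF psi ->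
  tact (dpow m) phi = tact (dpow m) psi -> phi = psi.
Proof.
move=> Fphi Fpsi E; have [_ inj] := FF_bij_dpow m.
have E0 : (fun g => phi g - psi g) = (fun=> 0).
  by apply: inj; [apply: FFB|rewrite tactBr E; apply/funext => g; rewrite subrr].
by apply/funext => g; apply/eqP; rewrite -subr_eq0 (congr1 (@^~ g) E0).
Qed.

Lemma dpow1 v : dpow [ffun w => (w == v) : nat] = dfac v.
Proof. exact: prod_exp1. Qed.

Lemma nat_ffun_ind (K : {ffun V -> nat} -> Prop) :
  (forall m : {ffun V -> nat}, (forall v, m v = 0%N) -> K m) ->
  (forall (m : {ffun V -> nat}) v, K m -> K [ffun w => (w == v) + m w]%N) ->
  forall m, K m.
Proof.
move=> K0 KS m; move: {2}(\sum_v m v)%N (erefl (\sum_v m v)%N) => n.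
elim: n m => [|n IH] m mn.
  by apply: K0 => v; apply/eqP; move/eqP: mn; rewrite sum_nat_eq0 => /forallP/(_ v).
have [v mv] : exists v, (0 < m v)%N.
  apply/existsP; rewrite -[X in is_true X]negbK; apply/negP => /existsPn m0.
  by move: mn; rewrite big1 // => v _; apply/eqP; rewrite -leqn0 leqNgt m0.
have -> : m = [ffun w => (w == v) + [ffun w => m w - (w == v)]%N w]%N.
  by apply/ffunP => w; rewrite !ffunE; case: eqP => [->|_]; rewrite ?subnKC // subn0.
apply: KS; apply: IH; apply/eqP; rewrite -eqSS -mn.
rewrite (bigD1 v) //= ffunE eqxx [X in _ == X](bigD1 v) //= -addSn subn1 prednK //.
rewrite eqn_add2l; apply/eqP/eq_bigr => w /negbTE wv.
by rewrite ffunE wv subn0.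
Qed.

Local Opaque dpow.

Lemma dpowC (m : {ffun V -> nat}) D phi : tact (dpow m) (tact D phi) = tact D (tact (dpow m) phi).
Proof. exact: tactC. Qed.

(** The exponents of the numerator and of the denominator of [gfrac_exp a k]. *)
Definition posz (k : int) : nat := if k is Posz n then n else 0%N.
Definition negz (k : int) : nat := if k is Negz n then n.+1 else 0%N.
Definition posexp (k : {ffun V -> int}) : {ffun V -> nat} := [ffun v => posz (k v)].
Definition negexp (k : {ffun V -> int}) : {ffun V -> nat} := [ffun v => negz (k v)].

Lemma posz_negz (k : int) : k = (posz k)%:Z - (negz k)%:Z.
Proof. by case: k => n /=; rewrite ?subr0 // sub0r NegzE. Qed.

(** The action on [FF] of the product of the (1 - t^[beta v]) ^ k v, where k v may be
    negative; the value 0 of [xget] is never used on [FF]. *)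
Definition op (k : {ffun V -> int}) phi : Gam -> int :=
  xget (fun=> 0) [set chi | FF chi /\ tact (dpow (negexp k)) chi = tact (dpow (posexp k)) phi]%classic.

Lemma opP k phi : FF phi ->
  FF (op k phi) /\ tact (dpow (negexp k)) (op k phi) = tact (dpow (posexp k)) phi.
Proof.
move=> Fphi; have [sur _] := FF_bij_dpow (negexp k).
case: (sur _ (FF_tact (dpow (posexp k)) Fphi)) => chi Fchi E.
by rewrite /op; case: xgetP => [psi _ [] //|/(_ chi) []].
Qed.

Lemma FF_op k phi : FF phi -> FF (op k phi).
Proof. by case/(opP k). Qed.

(** [op k] can be computed with any presentation of the fraction. *)
Lemma op_char k phi chi (m n : {ffun V -> nat}) : FF phi -> FF chi ->
  (forall v, k v = (n v)%:Z - (m v)%:Z) ->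
  (op k phi = chi <-> tact (dpow m) chi = tact (dpow n) phi).
Proof.
move=> Fphi Fchi knm; case: (opP k Fphi) => Fop opE.
have E : [ffun v => n v + negexp k v]%N = [ffun v => m v + posexp k v]%N :> {ffun V -> nat}.
  by apply/ffunP => v; have := knm v; have := posz_negz (k v); rewrite !ffunE; lia.
have E' : dpow n * dpow (negexp k) = dpow m * dpow (posexp k) by rewrite -!dpowD E.
have opmn : tact (dpow m) (op k phi) = tact (dpow n) phi.
  apply: (@dpow_inj (negexp k)); [exact: FF_tact|exact: FF_tact|].
  by rewrite dpowC opE -!tactM -E' mulrC.
split=> [<-|chimn]; first exact: opmn.
by apply: (dpow_inj Fop Fchi (m := m)); rewrite opmn chimn.
Qed.

Lemma opD j k phi : FF phi -> op (j + k) phi = op j (op k phi).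
Proof.
move=> Fphi; have Fk := FF_op k Fphi; have Fjk := FF_op j Fk.
apply/(op_char (m := [ffun v => negexp j v + negexp k v]%N)
  (n := [ffun v => posexp j v + posexp k v]%N) Fphi Fjk).
  by move=> v; rewrite !ffunE {1}[j v]posz_negz {1}[k v]posz_negz; lia.
have [_ ej] := opP j Fk; have [_ ek] := opP k Fphi.
rewrite (dpowD (negexp j) (negexp k)) (dpowD (posexp j) (posexp k)).
rewrite [LHS]tactM [RHS]tactM.
by rewrite [LHS]tactC ej [LHS]tactC ek.
Qed.

Lemma op_nat (n : {ffun V -> nat}) phi : FF phi ->
  op [ffun v => (n v)%:Z] phi = tact (dpow n) phi.
Proof.
move=> Fphi; apply/(op_char (m := [ffun=> 0%N]) (n := n) Fphi).
- exact: FF_tact.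
- by move=> v; rewrite !ffunE subr0.
by rewrite dpow0 tact1.
Qed.

Lemma op0 phi : FF phi -> op 0 phi = phi.
Proof.
move=> Fphi; have -> : 0 = [ffun v => ([ffun=> 0%N] v : nat)%:Z] :> {ffun V -> int}.
  by apply/ffunP => v; rewrite !ffunE.
by rewrite op_nat // dpow0 tact1.
Qed.

Lemma op_tact k D phi : FF phi -> op k (tact D phi) = tact D (op k phi).
Proof.
move=> Fphi; apply/(op_char (m := negexp k) (n := posexp k)).
- exact: FF_tact.
- exact/FF_tact/FF_op.
- by move=> v; rewrite !ffunE -posz_negz.
by rewrite dpowC (proj2 (opP k Fphi)) tactC.
Qed.

Lemma opDr k phi psi : FF phi -> FF psi ->
  op k (fun g => phi g + psi g) = (fun g => op k phi g + op k psi g).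
Proof.
move=> Fphi Fpsi; apply/(op_char (m := negexp k) (n := posexp k)).
- exact: FFD.
- by apply: FFD; apply: FF_op.
- by move=> v; rewrite !ffunE -posz_negz.
by rewrite !tactDr (proj2 (opP k Fphi)) (proj2 (opP k Fpsi)).
Qed.

Lemma opBr k phi psi : FF phi -> FF psi ->
  op k (fun g => phi g - psi g) = (fun g => op k phi g - op k psi g).
Proof.
move=> Fphi Fpsi; apply/(op_char (m := negexp k) (n := posexp k)).
- exact: FFB.
- by apply: FFB; apply: FF_op.
- by move=> v; rewrite !ffunE -posz_negz.
by rewrite !tactBr (proj2 (opP k Fphi)) (proj2 (opP k Fpsi)).
Qed.

Lemma op_shift k a phi : FF phi ->
  op k (fun g => phi (g + a)) = (fun g => op k phi (g + a)).
Proof. by move=> Fphi; rewrite -!tact_mon op_tact. Qed.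

(** An operator preserves vanishing on a set stable under all translations by the
    [beta v]. *)
Lemma op_vanish (S : Gam -> Prop) k phi : FF phi -> (forall v g, S g -> S (g + beta v)) ->
  (forall g, S g -> phi g = 0) -> forall g, S g -> op k phi g = 0.
Proof.
move=> Fphi Sb phi0; case: (opP k Fphi) => Fop opE.
pose K psi := forall g, S g -> psi g = 0.
pose good D := (forall psi, K psi -> K (tact D psi)) /\
  (forall psi, FF psi -> K (tact D psi) -> K psi).
have good1 : good 1 by split=> psi; rewrite tact1.
have goodM D E : good D -> good E -> good (D * E).
  move=> [D1 D2] [E1 E2]; split=> psi; first by rewrite tactM => /E1/D1.
  by move=> Fpsi; rewrite tactM => /D2/E2; apply => //; apply: FF_tact.
have gooddpow (m : {ffun V -> nat}) : good (dpow m).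
  apply: dpow_ind => // v; split=> [psi psi0 g Sg|psi Fpsi psi0].
    by rewrite tact_Bmon !psi0 // ?subr0 //; apply: Sb.
  by apply: (dfac_vanish Fpsi _ psi0) => g; apply: Sb.
apply: (proj2 (gooddpow (negexp k)) _ Fop); rewrite opE.
exact: (proj1 (gooddpow (posexp k))).
Qed.

(** The exponents of the Taylor expansion of f_H. *)
Definition cone g := exists n : V -> nat, g = \sum_v beta v *+ n v.

Lemma cone0 : cone 0.
Proof. by exists (fun=> 0%N); rewrite big1. Qed.

Lemma coneD v g : cone g -> cone (g + beta v).
Proof.
case=> n ->; exists (fun w => n w + (w == v))%N.
under [RHS]eq_bigr do rewrite mulrnDr.
rewrite big_split /=; congr (_ + _); rewrite (bigD1 v) //= eqxx big1 ?addr0 //.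
by move=> i /negbTE ->.
Qed.

(** The exponents of f_H. *)
Definition kappa : {ffun V -> int} := [ffun v => (valency G v)%:Z - 2].

(** The pairing of a function with f_H, i.e. the sum of the p_l phi ([l], l). *)
Definition pairing phi : int := op kappa phi 0.

(** Only the values on the exponents of the expansion matter for the pairing. *)
Lemma pairing_ext phi psi : FF phi -> FF psi ->
  (forall g, cone g -> phi g = psi g) -> pairing phi = pairing psi.
Proof.
move=> Fphi Fpsi E; apply/eqP; rewrite -subr_eq0 /pairing.
have <- : op kappa (fun g => phi g - psi g) 0 = op kappa phi 0 - op kappa psi 0.
  by rewrite opBr.
apply/eqP/(op_vanish (S := cone) kappa (FFB Fphi Fpsi)).
- exact: coneD.
- by move=> g /E ->; rewrite subrr.
exact: cone0.
Qed.

Lemma pairingD phi psi : FF phi -> FF psi ->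
  pairing (fun g => phi g + psi g) = pairing phi + pairing psi.
Proof. by move=> Fphi Fpsi; rewrite /pairing opDr. Qed.

Lemma pairingB phi psi : FF phi -> FF psi ->
  pairing (fun g => phi g - psi g) = pairing phi - pairing psi.
Proof. by move=> Fphi Fpsi; rewrite /pairing opBr. Qed.

Lemma FF0 : FF (fun=> 0).
Proof. by exists 0. Qed.

Lemma pairing0 : pairing (fun=> 0) = 0.
Proof. by apply: (op_vanish (S := cone) kappa FF0) cone0 => //; apply: coneD. Qed.

Lemma FFZ (c : int) phi : FF phi -> FF (fun g => c * phi g).
Proof. exact: (shift_closedZ FF_closed). Qed.

Lemma pairingZ (c : int) phi : FF phi -> pairing (fun g => c * phi g) = c * pairing phi.
Proof.
move=> Fphi; have pn n : pairing (fun g => n%:Z * phi g) = n%:Z * pairing phi.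
  elim: n => [|n IH].
    by under eq_fun do rewrite mul0r; rewrite pairing0 mul0r.
  have e (z : int) : n.+1%:Z * z = n%:Z * z + z by rewrite -addn1 PoszD mulrDl mul1r.
  rewrite e; under eq_fun do rewrite e.
  by rewrite (pairingD (FFZ n Fphi) Fphi) IH.
case: c => n //; rewrite NegzE.
have -> : (fun g => - n.+1%:Z * phi g) = (fun g => 0 - n.+1%:Z * phi g).
  by apply/funext => g; rewrite mulNr sub0r.
by rewrite (pairingB FF0 (FFZ n.+1 Fphi)) pairing0 pn sub0r mulNr.
Qed.

Lemma FF_sum I (r : seq I) (F : I -> Gam -> int) :
  (forall i, FF (F i)) -> FF (fun g => \sum_(i <- r) F i g).
Proof.
move=> FFF; elim: r => [|i r IH]; first by under eq_fun do rewrite big_nil; apply: FF0.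
by under eq_fun do rewrite big_cons; apply: FFD.
Qed.

Lemma pairing_sum I (r : seq I) (F : I -> Gam -> int) : (forall i, FF (F i)) ->
  pairing (fun g => \sum_(i <- r) F i g) = \sum_(i <- r) pairing (F i).
Proof.
move=> FFF; elim: r => [|i r IH].
  by under eq_fun do rewrite big_nil; rewrite pairing0 big_nil.
under eq_fun do rewrite big_cons.
by rewrite (pairingD (FFF i) (FF_sum r FFF)) IH big_cons.
Qed.

End Operators.

(** * Sums over exponents whose coordinates are small on both sides of a vertex *)

Section Separation.
Variables (V : finType) (G : plumbing_tree V).
Implicit Types (v w y : V) (B : {set V}).

Local Notation adj := (adj G).
Local Notation Gam := (discr G * QL V)%type.
Implicit Types (g : Gam) (phi psi chi : Gam -> int) (j k : {ffun V -> int}).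

(** The exponents of the factor at [v] alone. *)
Definition single v : {ffun V -> int} := [ffun w => (w == v)%:Z].

(** The exponents of the product of the factors at the vertices of [B]. *)
Definition ind B : {ffun V -> int} := [ffun w => (w \in B)%:Z].

Lemma valency_children v w : adj v w ->
  valency G w = #|[set y | adj w y && (y != v)]|.+1.
Proof.
move=> vw; rewrite /valency (cardsD1 v) inE (adj_sym G) vw add1n.
by congr _.+1; apply: eq_card => y; rewrite !inE andbC.
Qed.

Lemma ffun_sumE (I : finType) (P : pred I) (F : I -> {ffun V -> int}) x :
  (\sum_(i | P i) F i) x = \sum_(i | P i) F i x.
Proof. by apply: (big_morph (fun f : {ffun V -> int} => f x)) => [f1 f2|]; rewrite ffunE. Qed.

Lemma ffunMzE (f : {ffun V -> int}) (z : int) x : (f *~ z) x = f x * z.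
Proof.
case: z => n; rewrite ?NegzE ?mulrNz ?ffunE -!pmulrn ffunMnE -mulr_natr natz ?mulrN //.
Qed.

(** At most one branch contains x, so the sum has at most one nonzero term. *)
Lemma sum_branch (f : {ffun V -> int}) v (P : pred V) x : {subset P <= adj v} ->
  \sum_(y | P y) (if x \in branch G v y then f x else 0) =
  if [exists y, P y && (x \in branch G v y)] then f x else 0.
Proof.
move=> Pv; case: existsP => [[y /andP[Py xy]]|none].
  rewrite (bigD1 y) //= xy big1 ?addr0 // => y' /andP[Py' yy'].
  case: ifP => // xy'; case/eqP: yy'.
  exact: branch_inj (Pv _ Py') (Pv _ Py) xy' xy.
rewrite big1 // => y Py; case: ifP => // xy; case: none.
by exists y; rewrite Py.
Qed.

(** The exponents [f], kept on [B] only. *)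
Definition cut (f : {ffun V -> int}) B : {ffun V -> int} :=
  [ffun w => if w \in B then f w else 0].

(** Exponents on a branch: its root, then the branches of the children. *)
Lemma cut_branch (f : {ffun V -> int}) v w : adj v w ->
  cut f (branch G v w) =
  single w *~ f w + \sum_(y | adj w y && (y != v)) cut f (branch G w y).
Proof.
move=> vw; apply/ffunP => x; rewrite !ffunE ffun_sumE ffunMzE ffunE.
under eq_bigr do rewrite ffunE.
rewrite sum_branch; last by move=> y /andP[].
case: (eqVneq x w) => [->|xw].
  rewrite branch_self ?(eq_sym w) ?(adj_neq vw) // mul1r ifF ?addr0 //.
  by apply/existsP => -[y]; rewrite (negbTE (branch_root _ _ _)) andbF.
rewrite mul0r add0r branch_split //; congr (if _ then _ else _).
by apply: eq_existsb => y; rewrite andbA.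
Qed.

Lemma cut_root (f : {ffun V -> int}) v : f = single v *~ f v + \sum_(y | adj v y) cut f (branch G v y).
Proof.
apply/ffunP => x; rewrite !ffunE ffun_sumE ffunMzE ffunE.
under eq_bigr do rewrite ffunE.
rewrite sum_branch //; case: (eqVneq x v) => [->|xv].
  rewrite mul1r ifF ?addr0 //.
  by apply/existsP => -[y]; rewrite (negbTE (branch_root _ _ _)) andbF.
rewrite mul0r add0r ifT //; case: (branch_cover G xv) => y vy xy.
by apply/existsP; exists y; rewrite vy.
Qed.

(** L' inside H x (L (x) Q). *)
Definition iota (l : dual G) : Gam := (cls l, val l).

Lemma iotaB l l' : iota (l - l') = iota l - iota l'.
Proof. by rewrite /iota clsB raddfB. Qed.

HB.instance Definition _ := GRing.isZmodMorphism.Build (dual G) Gam iota iotaB.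

(** E_v, of trivial class. *)
Definition ev v : Gam := (0, Evec v).

(** E_v is the combination of dual basis vectors given by the intersection form. *)
Lemma ev_beta v : ev v = - (beta G v *~ selfint G v + \sum_(w | adj v w) beta G w).
Proof.
pose l : dual G := Estar G v *~ selfint G v + \sum_(w | adj v w) Estar G w.
have -> : beta G v *~ selfint G v + \sum_(w | adj v w) beta G w = iota l.
  by rewrite raddfD raddfMz raddf_sum.
have sum_eq (P : pred V) w : \sum_(i | P i) (i == w)%:R = (P w)%:R :> rat.
  rewrite big_mkcond (bigD1 w) //= eqxx big1 ?addr0; first by case: (P w).
  by move=> i /negbTE ->; case: ifP.
have lE : val l = - Evec v.
  apply: (form_inj (G := G)) => w; rewrite raddfD raddfMz raddf_sum formDl formMzl formNl.
  rewrite form_suml EstarE; under eq_bigr do rewrite EstarE.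
  rewrite sumrN sum_eq form_Evec ffunE.
  under [X in _ = - (_ + X)]eq_bigr do rewrite ffunE eq_sym.
  rewrite sum_eq (adj_sym G) opprD mulNrz; congr (- _ + _).
  by case: eqP => [->|_]; rewrite ?mul1r ?mul0r ?mul0rz.
have cl : cls l = 0.
  rewrite -cls0; apply/eqP; rewrite cls_eq subr0 lE; apply/forallP => w.
  by rewrite !ffunE rpredN; case: eqP.
by rewrite /iota cl lE /ev; congr (_, _); rewrite ?oppr0 ?opprK.
Qed.

Section Polynomiality.
Variables (A : {set V}) (u : V).
Hypothesis uA : u \notin A.

(** Invariance under translation by the E_v with v outside A and different from u. *)
Definition invar phi := forall v, v \notin A -> v != u -> forall g, phi (g + ev v) = phi g.

Lemma invar_op k phi : FF phi -> invar phi -> invar (op k phi).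
Proof.
move=> Fphi iphi v vA vu g; have := op_shift k (ev v) Fphi => /(congr1 (@^~ g)) <-.
by congr (op k _ g); apply/funext => g'; apply: iphi.
Qed.

(** On invariant functions, the fraction with exponents [k] preserves vanishing for very
    negative [u]-coordinate. A Laurent polynomial does so, whereas 1 / (1 - t^[beta v])
    in general does not. *)
Definition Pres k := forall phi, FF phi -> invar phi -> CC u phi -> CC u (op k phi).

Lemma Pres0 : Pres 0.
Proof. by move=> phi Fphi _ Cphi; rewrite op0. Qed.

Lemma PresD j k : Pres j -> Pres k -> Pres (j + k).
Proof.
move=> Pj Pk phi Fphi iphi Cphi; rewrite opD //; apply: Pj.
- exact: FF_op.
- exact: invar_op.
- exact: Pk.
Qed.

Lemma Pres_sum (P : pred V) (F : V -> {ffun V -> int}) :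
  (forall v, P v -> Pres (F v)) -> Pres (\sum_(v | P v) F v).
Proof. by move=> PF; apply: (big_ind Pres) => //; [apply: Pres0|apply: PresD]. Qed.

Lemma Pres_ge0 k : (forall v, 0 <= k v) -> Pres k.
Proof.
move=> k0 phi Fphi _ Cphi.
have -> : k = [ffun v => ([ffun v => `|k v|%N] v)%:Z].
  by apply/ffunP => v; rewrite !ffunE gez0_abs.
rewrite op_nat //; exact: (shift_closed_tact (CC_closed G u)).
Qed.

Lemma Pres_single v (z : int) : 0 <= z -> Pres (single v *~ z).
Proof.
by move=> z0; apply: Pres_ge0 => w; rewrite ffunMzE ffunE mulr_ge0.
Qed.

(** The translations that fix [chi] up to an element of [CC u]; they form a group. *)
Definition stab chi (a : Gam) := CC u (fun g => chi g - chi (g + a)).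

Lemma stabD chi a b : stab chi a -> stab chi b -> stab chi (a + b).
Proof.
move=> sa sb; have [_ _ Cs] := CC_closed G u.
have := shift_closedD (CC_closed G u) sa (Cs a _ sb).
by congr (CC u); apply/funext => g; rewrite addrA addrA subrK.
Qed.

Lemma stabN chi a : stab chi a -> stab chi (- a).
Proof.
move=> sa; have [_ _ Cs] := CC_closed G u.
have := shift_closedN (CC_closed G u) (Cs (- a) _ sa).
by congr (CC u); apply/funext => g; rewrite subrK opprB.
Qed.

Lemma stab0 chi : stab chi 0.
Proof. by exists 0 => g _; rewrite addr0 subrr. Qed.

Lemma stabMz chi a (z : int) : stab chi a -> stab chi (a *~ z).
Proof.
move=> sa; have sn n : stab chi (a *+ n).
  by elim: n => [|n IH]; rewrite ?mulr0n ?mulrS; [apply: stab0|apply: stabD].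
by case: z => n; rewrite ?NegzE ?mulrNz -?pmulrn; [|apply: stabN]; apply: sn.
Qed.

Lemma stab_op k v phi : FF phi -> CC u (op (single v + k) phi) -> stab (op k phi) (beta G v).
Proof.
move=> Fphi; rewrite opD //.
have -> : single v = [ffun w => ([ffun w => (w == v) : nat] w)%:Z].
  by apply/ffunP => w; rewrite !ffunE.
rewrite op_nat; last exact: FF_op.
by rewrite dpow1; congr (CC u); apply/funext => g; rewrite tact_Bmon.
Qed.

Lemma disjoint_branch v w y B : adj v w -> adj w y -> y != v ->
  [disjoint B & branch G v w] -> [disjoint B & branch G w y].
Proof. by move=> vw wy yv; apply/disjointWr/branch_sub. Qed.

(** The children of w contribute kappa w + 1 copies of the factor at w. *)
Lemma sum_single_children v w : adj v w ->
  \sum_(y | adj w y && (y != v)) single w = single w *~ (kappa G w + 1).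
Proof.
move=> vw; rewrite sumr_const ffunE (valency_children vw) -addn1 PoszD.
have -> : #|fun y => adj w y && (y != v)| = #|[set y | adj w y && (y != v)]|.
  by apply: eq_card => y; rewrite inE.
by rewrite pmulrn; congr (_ *~ _); lia.
Qed.

Lemma single_kap_children v w : adj v w ->
  single w + cut (kappa G) (branch G v w) =
  \sum_(y | adj w y && (y != v)) (single w + cut (kappa G) (branch G w y)).
Proof.
move=> vw; rewrite big_split /= (sum_single_children vw) cut_branch // addrA.
by congr (_ + _); rewrite mulrzDr mulr1z addrC.
Qed.

(** A branch away from [A] and [u] contributes a polynomial once multiplied by the
    factor at either end of its edge. The factor at [w] is distributed over the branches
    of the children of [w]. For the factor at [v], up to the E_w that acts trivially,
    [beta v] is an integral combination of [beta w] and of the [beta y], y a child of [w],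
    and each of these translations belongs to [stab]. *)
Lemma Pres_branch v w : adj v w -> u \notin branch G v w ->
  [disjoint A & branch G v w] ->
  Pres (single v + cut (kappa G) (branch G v w)) /\
  Pres (single w + cut (kappa G) (branch G v w)).
Proof.
move: {2}#|branch G v w|.+1 (ltnSn #|branch G v w|) => n.
elim: n v w => // n IH v w; rewrite ltnS => le_n vw uB AB.
have IHc y : adj w y && (y != v) ->
    Pres (single w + cut (kappa G) (branch G w y)) /\
    Pres (single y + cut (kappa G) (branch G w y)).
  case/andP=> wy yv; apply: IH => //.
  - exact: leq_trans (branch_proper vw wy yv) le_n.
  - by apply: contra uB; apply/fintype.subsetP/branch_sub.
  - exact: disjoint_branch vw wy yv AB.
have Pw : Pres (single w + cut (kappa G) (branch G v w)).
  by rewrite single_kap_children //; apply: Pres_sum => y /IHc[].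
split=> // phi Fphi iphi Cphi; set k := cut _ _ in Pw *.
have stw : stab (op k phi) (beta G w) by apply: stab_op => //; apply: Pw.
have wB : w \in branch G v w by rewrite branch_self // eq_sym (adj_neq vw).
have ste : stab (op k phi) (ev w).
  exists 0 => g _; rewrite (invar_op k Fphi iphi) ?subrr //.
    by apply/negP => wA; move/pred0P/(_ w): AB; rewrite /= wA wB.
  by apply: contraNneq uB => <-.
have sty y : adj w y && (y != v) -> stab (op k phi) (beta G y).
  move=> Cy; apply: stab_op => //; apply: (_ : Pres _) => //.
  have -> : single y + k = (single y + cut (kappa G) (branch G w y)) +
      \sum_(y' | (adj w y' && (y' != v)) && (y' != y))
        (single w + cut (kappa G) (branch G w y')).
    apply: (addrI (single w)); rewrite addrCA /k (single_kap_children vw) (bigD1 y) //=.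
    by rewrite !addrA; congr (_ + _); rewrite [single w + single y]addrC -!addrA.
  apply: PresD; first by case: (IHc _ Cy).
  by apply: Pres_sum => y' /andP[/IHc[]].
have stv : stab (op k phi) (beta G v).
  have -> : beta G v = - (ev w + beta G w *~ selfint G w
      + \sum_(y | adj w y && (y != v)) beta G y).
    have zmodE (M : zmodType) (b s t : M) : b = - (- (s + (b + t)) + s + t).
      by rewrite addrCA -[_ + s + t]addrA (opprD b) subrK opprK.
    by rewrite ev_beta (bigD1 v) 1?(adj_sym G) //=; apply: zmodE.
  apply/stabN/stabD; first by apply: stabD => //; apply: stabMz.
  by apply: (big_ind (stab (op k phi))) => //; [apply: stab0|apply: stabD].
rewrite opD //.
have -> : single v = [ffun x => ([ffun x => (x == v) : nat] x)%:Z].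
  by apply/ffunP => x; rewrite !ffunE.
rewrite op_nat; last exact: FF_op.
by rewrite dpow1; move: stv; congr (CC u); apply/funext => g; rewrite tact_Bmon.
Qed.

(** The exponents of f_H multiplied by the factors at the vertices of [A]. *)
Definition kapA : {ffun V -> int} := ind A + kappa G.

(** Branches meeting [A] need no extra factor; each of the others uses one factor at
    their common root [w]. *)
Lemma Pres_glue w (P : pred V) (z : int) :
  (forall y, P y -> adj w y) -> (forall y, P y -> u \notin branch G w y) ->
  (forall y, P y -> ~~ [disjoint A & branch G w y] -> Pres (cut kapA (branch G w y))) ->
  (#|[set y | P y && [disjoint A & branch G w y]]|%:Z <= z) ->
  Pres (single w *~ z + \sum_(y | P y) cut kapA (branch G w y)).
Proof.
move=> Pw Pu IH le_z; set s := #|_| in le_z.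
have -> : single w *~ z + \sum_(y | P y) cut kapA (branch G w y) =
    single w *~ (z - s%:Z) + \sum_(y | P y) (cut kapA (branch G w y) +
      if [disjoint A & branch G w y] then single w else 0).
  rewrite big_split /= -big_mkcondr /= sumr_const.
  have -> : #|fun y => P y && [disjoint A & branch G w y]| = s.
    by apply: eq_card => y; rewrite inE.
  by rewrite mulrzBr -pmulrn addrACA addNr addr0.
apply: PresD; first by apply: Pres_single; rewrite subr_ge0.
apply: Pres_sum => y Py; case: ifP => [dis|/negbT hit]; last first.
  by rewrite addr0; apply: IH.
have -> : cut kapA (branch G w y) = cut (kappa G) (branch G w y).
  apply/ffunP => x; rewrite !ffunE; case: ifP => // xB.
  suff -> : x \in A = false by rewrite add0r.
  by apply/negP => xA; move/pred0P/(_ x): dis; rewrite /= xA xB.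
by rewrite addrC; case: (Pres_branch (Pw _ Py) (Pu _ Py) dis).
Qed.

(** A branch meeting [A] needs no factor at its own edge. *)
Lemma Pres_branchA v w : adj v w -> u \notin branch G v w ->
  ~~ [disjoint A & branch G v w] -> Pres (cut kapA (branch G v w)).
Proof.
move: {2}#|branch G v w|.+1 (ltnSn #|branch G v w|) => n.
elim: n v w => // n IH v w; rewrite ltnS => le_n vw uB hit.
have uBy y : adj w y && (y != v) -> u \notin branch G w y.
  by case/andP=> wy yv; apply: contra uB; apply/fintype.subsetP/branch_sub.
rewrite cut_branch //; apply: Pres_glue => // [y /andP[]//|y Cy|].
  case/andP: (Cy) => wy yv; apply: IH => //; last exact: uBy.
  exact: leq_trans (branch_proper vw wy yv) le_n.
set C := [set y | _]; pose D := [set y | adj w y && (y != v)].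
have CD : C \subset D by apply/fintype.subsetP => y; rewrite !inE => /andP[].
rewrite !ffunE (valency_children vw) -/D.
have := subset_leq_card CD; case: (boolP (w \in A)) => wA CDle; first by lia.
suff : (#|C| < #|D|)%N by lia.
apply: proper_card; apply/properP; split=> //.
case/pred0Pn: hit => x /= /andP[xA xB].
have xw : x != w by apply: contraNneq wA => <-.
move: xB; rewrite branch_split // => /existsP[y /and3P[wy yv xy]].
exists y; first by rewrite inE wy.
rewrite inE wy yv /=; apply/negP => /pred0P/(_ x).
by rewrite /= xA xy.
Qed.

(** If [u] separates two vertices of [A], the poles at the leaves outside [A] are
    cancelled. *)
Lemma Pres_kapA w1 w2 a1 a2 : adj u w1 -> adj u w2 -> w1 != w2 ->
  a1 \in A -> a2 \in A -> a1 \in branch G u w1 -> a2 \in branch G u w2 -> Pres kapA.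
Proof.
move=> uw1 uw2 w12 a1A a2A a1w1 a2w2.
rewrite (cut_root kapA u); apply: Pres_glue => // [y _|y uy|].
- exact: branch_root.
- by apply: Pres_branchA => //; apply: branch_root.
set C := [set y | _]; rewrite !ffunE (negbTE uA) add0r /valency.
set N := [set y | adj u y].
have hit w a : a \in A -> a \in branch G u w -> w \notin C.
  move=> aA aw; rewrite inE; apply/negP => /andP[_ /pred0P/(_ a)].
  by rewrite /= aA aw.
suff /subset_leq_card : C \subset N :\ w1 :\ w2.
  have w1N : w1 \in N by rewrite inE.
  have w2N : w2 \in N :\ w1 by rewrite !inE uw2 eq_sym w12.
  have := cardsD1 w1 N; have := cardsD1 w2 (N :\ w1); rewrite w1N w2N.
  by move: #|C| #|N| #|N :\ w1| #|N :\ w1 :\ w2| => c n n1 n2; lia.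
apply/fintype.subsetP => y yC; rewrite !inE.
have -> : adj u y by move: yC; rewrite inE => /andP[].
rewrite andbT; apply/andP; split; apply: contraTneq yC => ->.
  exact: hit a2w2.
exact: hit a1w1.
Qed.

Variable x : dual G.

(** Exponents x - sum_v c_v E*_v with c_v >= k_v for [v] outside [A]. *)
Definition Reg k (g : Gam) := exists c : {ffun V -> int},
  (forall v, v \notin A -> k v <= c v) /\ g = iota x - \sum_v beta G v *~ c v.

Lemma Reg_shift k k' v (z : int) g : Reg k g ->
  (forall w, w \notin A -> k' w + single v w * z <= k w) -> Reg k' (g + beta G v *~ z).
Proof.
case=> c [kc ->] kk'; exists (c - single v *~ z); split=> [w wA|].
  have := kc w wA; have := kk' w wA; rewrite !ffunE ffunMzE ffunE => h1 h2.
  by rewrite lerBrDr; apply: le_trans h1 h2.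
rewrite -addrA [- _ + _]addrC -opprB; congr (_ - _).
under [RHS]eq_bigr do rewrite !ffunE ffunMzE ffunE mulrzBr.
rewrite sumrB; congr (_ - _); rewrite (bigD1 v) //= eqxx mul1r big1 ?addr0 //.
by move=> w /negbTE ->; rewrite mul0r mulr0z.
Qed.

(** Vanishing on the region [Reg k]. *)
Definition vanish k phi := forall g, Reg k g -> phi g = 0.

Lemma vanish_dfac k v phi : vanish k phi -> vanish (k + single v) (tact (dfac G v) phi).
Proof.
move=> phi0 g Rg; rewrite tact_Bmon !phi0 ?subr0 //.
  rewrite -[beta G v]mulr1z; apply: (Reg_shift Rg) => w _.
  by rewrite !ffunE mulr1.
rewrite -[g]addr0 -[0](mulr0z (beta G v)); apply: (Reg_shift Rg) => w _.
by rewrite !ffunE mulr0 addr0 lerDl.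
Qed.

(** Translating by - [beta v] stays in the region and eventually leaves the support. *)
Lemma vanish_dfacV k v phi : CC u phi ->
  vanish k (tact (dfac G v) phi) -> vanish (k - single v) phi.
Proof.
move=> [N phiN] phi0 g Rg.
have E n : phi g = phi (g - beta G v *+ n).
  elim: n => [|n ->]; first by rewrite subr0.
  have -> : g - beta G v *+ n = g - beta G v *+ n.+1 + beta G v.
    by rewrite mulrSr opprD addrA subrK.
  apply/eqP; rewrite eq_sym -subr_eq0 -tact_Bmon phi0 // pmulrn -mulrNz.
  apply: (Reg_shift Rg) => w _; rewrite !ffunE.
  rewrite lerD2l; case: (w == v); first by rewrite mul1r lerN2.
  by rewrite mul0r oppr0.
have [n nN] : exists n : nat, (g - beta G v *+ n).2 u < N.
  case: (beta_large (0 : Gam) v (g.2 u - N + 1)) => M /(_ M (leqnn M) u) MN.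
  exists M; move: MN; rewrite add0r /= !ffunE; lra.
by rewrite (E n) phiN.
Qed.

Lemma vanish_dpow (m : {ffun V -> nat}) k phi : vanish k phi ->
  vanish [ffun v => k v + (m v)%:Z] (tact (dpow G m) phi).
Proof.
elim/nat_ffun_ind: m k phi => [m m0|m v IH] k phi phi0.
  have -> : m = [ffun=> 0%N] by apply/ffunP => v; rewrite m0 ffunE.
  rewrite dpow0 tact1; move: phi0; congr (vanish _ phi).
  by apply/ffunP => v; rewrite !ffunE addr0.
have -> : [ffun w => (w == v) + m w]%N = [ffun w => [ffun w => (w == v) : nat] w + m w]%N.
  by apply/ffunP => w; rewrite !ffunE.
rewrite dpowD dpow1 tactM.
have := vanish_dfac (v := v) (IH k phi phi0); congr vanish.
by apply/ffunP => w; rewrite !ffunE PoszD; lia.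
Qed.

Lemma vanish_dpowV (m : {ffun V -> nat}) k phi : CC u phi ->
  vanish k (tact (dpow G m) phi) -> vanish [ffun v => k v - (m v)%:Z] phi.
Proof.
elim/nat_ffun_ind: m k phi => [m m0|m v IH] k phi Cphi.
  have -> : m = [ffun=> 0%N] by apply/ffunP => v; rewrite m0 ffunE.
  rewrite dpow0 tact1; congr (vanish _ phi).
  by apply/ffunP => v; rewrite !ffunE subr0.
have -> : [ffun w => (w == v) + m w]%N = [ffun w => [ffun w => (w == v) : nat] w + m w]%N.
  by apply/ffunP => w; rewrite !ffunE.
rewrite dpowD dpow1 tactM => /(vanish_dfacV _)/IH; rewrite /vanish => V0 g Rg.
apply: V0 => //; first exact: (shift_closed_tact (CC_closed G u)).
move: Rg; congr (Reg _ g); apply/ffunP => w; rewrite !ffunE PoszD opprD.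
by rewrite addrA.
Qed.

(** When f_H times the factors at [A] acts polynomially, an invariant function vanishing
    at x - sum_v c_v E*_v as soon as c_v > 0 for all [v] outside [A] has pairing 0 with
    f_H: applying f_H shifts the region of vanishing by the exponents delta_v - 2, and the
    exponent 0 is in the shifted region. *)
Lemma pairing_eq0 phi : FF phi -> CC u phi -> invar phi -> Pres kapA ->
  vanish [ffun=> 1] phi -> in_shifted_interior x -> pairing phi = 0.
Proof.
move=> Fphi Cphi iphi PA phi0 [a [a0 xE]].
have Cop := PA phi Fphi iphi Cphi; have [_ opE] := opP kapA Fphi.
have := vanish_dpow (m := posexp kapA) phi0; rewrite -opE => /(vanish_dpowV Cop) op0.
have Fk := FF_op (kappa G) Fphi.
have kE : op kapA phi = tact (dpow G [ffun v => (v \in A) : nat]) (op (kappa G) phi).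
  by rewrite /kapA opD // -op_nat //; congr (op _ _); apply/ffunP => v; rewrite !ffunE.
pose R := Reg (kappa G + [ffun=> 1]).
have R0 : R 0.
  exists [ffun v => kappa G v + (a v)%:Z]; split=> [v _|].
    by rewrite !ffunE lerD2l; apply: (a0 v).
  apply/eqP; rewrite eq_sym subr_eq0 xE; apply/eqP.
  rewrite raddfD !raddf_sum -big_split; apply: eq_bigr => v _ /=.
  have e1 (z : int) : iota (Estar G v *~ z) = beta G v *~ z by apply: raddfMz.
  have e2 (n : nat) : iota (Estar G v *+ n) = beta G v *+ n by apply: raddfMn.
  by rewrite e1 e2 [in RHS]ffunE [kappa G v]ffunE [RHS]mulrzDr -pmulrn.
suff : forall g, R g -> op (kappa G) phi g = 0 by move/(_ 0 R0).
have op1 g : R g -> op kapA phi g = 0.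
  case=> c [kc gE]; apply: op0; exists c; split=> // v vA.
  have E j : [ffun v => [ffun w => [ffun=> 1] w + (posexp j w)%:Z] v - (negexp j v)%:Z] v
      = j v + 1 by rewrite !ffunE [in RHS](posz_negz (j v)) -addrA addrC.
  have := kc v vA; rewrite E.
  by rewrite [X in X <= _]ffunE [(ind A + _) v]ffunE [ind A v]ffunE (negbTE vA) add0r [X in _ + X]ffunE.
have := op1; rewrite kE; move: Fk.
move: (op _ _) => psi Fpsi.
have RA v : v \in A -> forall g, R g -> R (g + beta G v).
  move=> vA g Rg; rewrite -[beta G v]mulr1z; apply: (Reg_shift Rg) => w wA.
  by rewrite !ffunE; case: eqP => [wv|_]; [rewrite wv vA in wA|lia].
pose m := [ffun v => (v \in A) : nat]; rewrite -/m.
have mA v : (0 < m v)%N -> v \in A by rewrite ffunE; case: (v \in A).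
move: Fpsi mA; elim/nat_ffun_ind: m psi => [m m0|m v IH] psi Fpsi mA.
  have -> : m = [ffun=> 0%N] by apply/ffunP => v; rewrite m0 ffunE.
  by rewrite dpow0 tact1.
have -> : [ffun w => (w == v) + m w]%N = [ffun w => [ffun w => (w == v) : nat] w + m w]%N.
  by apply/ffunP => w; rewrite !ffunE.
rewrite dpowD dpow1 tactM => psi0.
apply: IH => // [w mw|]; first by apply: mA; rewrite ffunE addn_gt0 mw orbT.
apply: (dfac_vanish (S := R) (v := v)) psi0 => //; first exact: FF_tact.
by apply: RA; apply: mA; rewrite ffunE eqxx.
Qed.

End Polynomiality.

End Separation.

(** * Reduction to vertices and edges *)

Section Growth.
Variables (V : finType) (G : plumbing_tree V) (h : discr G) (x : dual G).
Implicit Types (u v w : V) (A S I : {set V}) (b : {set V} -> bool).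

Local Notation adj := (adj G).
Local Notation Gam := (discr G * QL V)%type.

(** The vertices where the exponent is smaller than [x]. *)
Definition low (g : Gam) : {set V} := [set v | g.2 v < x v].

(** The indicator function of the exponents of class [h] whose low set satisfies [b]. *)
Definition low_fun b (g : Gam) : int := ((g.1 == h) && b (low g))%:R.

Lemma FF_low_fun b : b finset.set0 = false -> FF (low_fun b).
Proof.
move=> b0; exists (\sum_v `|x v|) => g gN; rewrite /low_fun.
suff -> : low g = finset.set0 by rewrite b0 andbF.
apply/setP => v; rewrite !inE; apply/negbTE; rewrite -leNgt.
apply: le_trans (gN v); rewrite (bigD1 v) //=; apply: le_trans (ler_norm _) _.
by rewrite lerDl sumr_ge0.
Qed.

(** The sum of the p_l over the l of class [h] whose set of low vertices
    satisfies [b]. *)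
Definition low_sum b : int := pairing (low_fun b).

Lemma eq_low_sum b b' : b =1 b' -> low_sum b = low_sum b'.
Proof. by move=> bb'; congr pairing; apply/funext => g; rewrite /low_fun bb'. Qed.

Lemma low_sum_false b : (forall I, b I = false) -> low_sum b = 0.
Proof.
move=> b0; rewrite -[RHS](@pairing0 V G); congr pairing; apply/funext => g.
by rewrite /low_fun b0 andbF.
Qed.

Lemma low_sum_lin b b1 b2 b3 : b finset.set0 = false ->
  b1 finset.set0 = false -> b2 finset.set0 = false ->
  b3 finset.set0 = false ->
  (forall I, (b I)%:R = (b1 I)%:R + (b2 I)%:R - (b3 I)%:R :> int) ->
  low_sum b = low_sum b1 + low_sum b2 - low_sum b3.
Proof.
move=> b0 b10 b20 b30 E; rewrite /low_sum.
rewrite -(pairingD (FF_low_fun b10) (FF_low_fun b20)) -pairingB; first last.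
- exact: FF_low_fun.
- by apply: FFD; apply: FF_low_fun.
congr pairing; apply/funext => g; rewrite /low_fun.
by case: (g.1 == h) => //=; rewrite subr0.
Qed.

(** If [u] separates two elements of [A], the exponents for which [A] is low and [u] is
    not contribute zero. If l = x - sum c_v E*_v is one of them, some c_v with v outside
    [A] is nonpositive: otherwise y = x - l is positive on [A] and strictly superharmonic
    outside, hence nonnegative, and it cannot vanish at [u]. *)
Lemma low_sum_sep A u w1 w2 a1 a2 : in_shifted_interior x -> u \notin A ->
  adj u w1 -> adj u w2 -> w1 != w2 ->
  a1 \in A -> a2 \in A -> a1 \in branch G u w1 -> a2 \in branch G u w2 ->
  low_sum (fun I => (A \subset I) && (u \notin I)) = 0.
Proof.
move=> hx uA uw1 uw2 w12 a1A a2A a1w1 a2w2.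
apply: (@pairing_eq0 V G A u uA x) => //.
- apply: FF_low_fun; apply/negbTE; rewrite negb_and; apply/orP; left.
  by apply/negP => /fintype.subsetP/(_ a1 a1A); rewrite inE.
- by exists (x u) => g gu; rewrite /low_fun inE gu andbF andbF.
- move=> v vA vu g; rewrite /low_fun /= addr0; congr (_ && _)%:R.
  have low_eq w : w != v -> (w \in low (g + ev G v)) = (w \in low g).
    by move=> wv; rewrite !inE /= !ffunE eq_sym (negbTE wv) addr0.
  rewrite low_eq 1?eq_sym //; congr (_ && _).
  apply/fintype.subsetP/fintype.subsetP => AI a aA; have := AI a aA;
    by rewrite low_eq //; apply: contraNneq vA => <-.
- exact: (Pres_kapA uA uw1 uw2 w12 a1A a2A a1w1 a2w2).
move=> g [c [c1 gE]]; rewrite /low_fun; case: eqP => //= _.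
apply/eqP; rewrite -[0]/(false%:R) eqr_nat eqb0.
apply/negP => /andP[/fintype.subsetP AI uI].
pose y : QL V := \sum_v val (Estar G v) *~ c v.
have yE v : y v = x v - g.2 v.
  have -> : g.2 = val x - y.
    rewrite gE /=; congr (_ - _); rewrite /y.
    rewrite (raddf_sum (@snd (discr G) (QL V))); apply: eq_bigr => w _.
    exact: (raddfMz (@snd (discr G) (QL V))).
  by rewrite !ffunE opprB addrCA subrr addr0.
have yF v : form adj (selfint G) y (Evec v) = - (c v)%:~R.
  rewrite form_suml (bigD1 v) //= formMzl EstarE eqxx big1 ?addr0 ?mulNrz //.
  by move=> w /negbTE wv; rewrite formMzl EstarE wv oppr0 mul0rz.
have yI v : v \notin low g -> y v <= 0 by rewrite inE -leNgt yE subr_le0.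
have y_ge0 : forall v, 0 <= y v.
  apply: (minimum_principle (G := G)) => v yv; rewrite yF oppr_le0.
  have vA : v \notin A.
    by apply: contraTN yv => /AI; rewrite inE yE -leNgt -subr_gt0 => /ltW.
  by rewrite ler0z; apply: le_trans (c1 v vA); rewrite ffunE.
have yu : y u = 0 by apply/eqP; rewrite eq_le yI // y_ge0.
have := yF u; rewrite form_Evec yu mul0r add0r => E.
have : 0 <= \sum_(v | adj u v) y v by apply: sumr_ge0.
by rewrite E oppr_ge0 lerz0 leNgt (lt_le_trans _ (c1 u uA)) // ffunE.
Qed.

(** Adjacency inside [S], and connectedness of [S]. *)
Definition inside S : rel V := [rel a c | [&& adj a c, a \in S & c \in S]].

Definition conn S := forall a c, a \in S -> c \in S -> connect (inside S) a c.

Lemma conn_avoid S v a c : conn S -> v \notin S -> a \in S -> c \in S ->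
  connect (avoid G v) a c.
Proof.
move=> cS vS aS cc; apply: connect_sub (cS a c aS cc) => s t /and3P[st sS tS].
apply: connect1; rewrite /avoid /= st /=.
by apply/andP; split; apply: contraNneq vS => <-.
Qed.

Section Step.
Variables (S : {set V}) (u v : V).
Hypotheses (hx : in_shifted_interior x) (cS : conn S).
Hypotheses (uS : u \in S) (vS : v \notin S) (uv : adj u v).

Lemma step_branch a : a \in S -> a != u ->
  exists w, [/\ adj u w, w != v & a \in branch G u w].
Proof.
move=> aS au; case: (branch_cover G au) => w uw aw; exists w; split=> //.
apply: contraTneq aw => ->; rewrite branchC // !inE negbK (adj_neq uv) /=.
exact: (conn_avoid cS vS uS aS).
Qed.

(** [low_sum_sep] with one more condition, that some vertex of [s] is low; by
    inclusion-exclusion on [s]. *)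
Lemma low_sum_step_seq (s : seq V) A : {subset s <= S} -> A \subset S ->
  low_sum (fun I => [&& v \in I, u \notin I, A \subset I & has (mem I) s]) = 0.
Proof.
elim: s A => [|a s IH] A sS AS; first by apply: low_sum_false => I; rewrite !andbF.
have aS : a \in S by apply: sS; rewrite mem_head.
have sS' : {subset s <= S} by move=> t ts; apply: sS; rewrite inE ts orbT.
have aAS : a |: A \subset S by rewrite finset.subUset finset.sub1set aS.
rewrite (low_sum_lin (b1 := fun I => (v |: (a |: A) \subset I) && (u \notin I))
  (b2 := fun I => [&& v \in I, u \notin I, A \subset I & has (mem I) s])
  (b3 := fun I => [&& v \in I, u \notin I, a |: A \subset I & has (mem I) s])).
- rewrite !IH // subr0 addr0.
  case: (boolP (u \in a |: A)) => [uaA|uaA].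
    apply: low_sum_false => I; apply/negP => /andP[/fintype.subsetP/(_ u)].
    by rewrite inE uaA orbT => ->.
  have au : a != u by apply: contraNneq uaA => ->; rewrite !inE eqxx.
  case: (step_branch aS au) => w [uw wv aw].
  apply: (@low_sum_sep _ u v w v a) => //.
  - by rewrite inE negb_or uaA andbT inE (adj_neq uv).
  - by rewrite eq_sym.
  - by rewrite !inE eqxx.
  - by rewrite !inE eqxx orbT.
  - by rewrite branch_self // eq_sym (adj_neq uv).
- by rewrite inE.
- by rewrite finset.subUset finset.sub1set inE.
- by rewrite inE.
- by rewrite inE.
move=> I; rewrite !finset.subUset !finset.sub1set /=.
by case: (v \in I); case: (u \in I); case: (A \subset I); case: (a \in I);
  case: (has _ _).
Qed.

(** Adding a leaf [v], attached at [u], to the subtree [S]. *)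
Lemma low_sum_step :
  low_sum (fun I => (v |: S) :&: I != finset.set0) =
  low_sum (fun I => S :&: I != finset.set0) + low_sum (fun I => [set v] \subset I)
  - low_sum (fun I => [set u; v] \subset I).
Proof.
pose b I := [&& v \in I, u \notin I, finset.set0 \subset I & has (mem I) (enum S)].
have bE I : b I = [&& v \in I, u \notin I & S :&: I != finset.set0].
  have hE : has (mem I) (enum S) = (S :&: I != finset.set0).
    apply/idP/idP => [/hasP[a]|/finset.set0Pn[a]].
      by rewrite mem_enum => aS aI; apply/finset.set0Pn; exists a; rewrite inE aS.
    by rewrite inE => /andP[aS aI]; apply/hasP; exists a; rewrite // mem_enum.
  by rewrite /b finset.sub0set hE.
rewrite (low_sum_lin (b1 := fun I => S :&: I != finset.set0)
  (b2 := fun I => (v \in I) && (u \notin I)) (b3 := b)).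
- rewrite [low_sum b]low_sum_step_seq ?finset.sub0set //; last by move=> t; rewrite mem_enum.
  rewrite subr0 -addrA; congr (_ + _).
  rewrite (low_sum_lin (b1 := fun I => [set v] \subset I) (b2 := fun=> false)
    (b3 := fun I => [set u; v] \subset I)).
  + by rewrite [low_sum (fun=> false)]low_sum_false // addr0.
  + by rewrite inE.
  + by rewrite finset.sub1set inE.
  + by [].
  + by rewrite finset.subUset !finset.sub1set inE.
  move=> I; rewrite finset.subUset !finset.sub1set.
  by case: (v \in I); case: (u \in I).
- by rewrite finset.setI0 eqxx.
- by rewrite finset.setI0 eqxx.
- by rewrite inE.
- by rewrite bE inE.
move=> I; rewrite bE; have -> : ((v |: S) :&: I != finset.set0) = (v \in I) || (S :&: I != finset.set0).
  rewrite finset.setIUl finset.setU_eq0 negb_and; congr (_ || _).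
  by apply/finset.set0Pn/idP => [[a]|vI]; [rewrite !inE => /andP[/eqP->]|exists v; rewrite !inE eqxx].
have : u \in I -> S :&: I != finset.set0.
  by move=> uI; apply/finset.set0Pn; exists u; rewrite inE uS.
case: (v \in I); case: (u \in I); case: (S :&: I != _) => //= H.
by have := H isT.
Qed.

Lemma conn_step : conn (v |: S).
Proof.
have sub : subrel (inside S) (inside (v |: S)).
  by move=> a c /and3P[ac aS cc]; rewrite /inside /= ac !inE aS cc !orbT.
have ins a c : a \in S -> c \in S -> connect (inside (v |: S)) a c.
  move=> aS cc; apply: connect_sub (cS aS cc) => s t /sub st.
  exact: connect1.
have vu : inside (v |: S) v u by rewrite /inside /= (adj_sym G) uv !inE eqxx uS orbT.
have uv' : inside (v |: S) u v by rewrite /inside /= uv !inE eqxx uS orbT.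
move=> a c; rewrite !inE => /predU1P[->|aS] /predU1P[->|cc].
- exact: connect0.
- exact: connect_trans (connect1 vu) (ins _ _ uS cc).
- exact: connect_trans (ins _ _ aS uS) (connect1 uv').
- exact: ins.
Qed.

Lemma edges_step : [set e in edges G | e \subset v |: S] =
  [set u; v] |: [set e in edges G | e \subset S].
Proof.
have vu : adj v u by rewrite (adj_sym G).
have only c : adj v c -> c \in S -> c = u.
  move=> vc cc; have cu : c \in branch G v u.
    by rewrite inE (adj_neq uv) (conn_avoid cS vS uS cc).
  have ccb : c \in branch G v c by rewrite branch_self // eq_sym (adj_neq vc).
  exact: (branch_inj vc vu ccb cu).
apply/setP => e; rewrite !inE; apply/andP/idP => [[/existsP[a /existsP[c /andP[ac /eqP->]]]]|].
  rewrite finset.subUset !finset.sub1set !inE => /andP[].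
  case: (eqVneq a v) ac => [-> vc _|av ac /= aS].
    case: (eqVneq c v) vc => [->|_ vc /= cc]; first by rewrite adj_irr.
    by rewrite (only c vc cc) finset.setUC eqxx.
  case: (eqVneq c v) ac => [-> va _|_ ac /= cc].
    by rewrite (only a _ aS) ?eqxx // (adj_sym G).
  apply/orP; right; rewrite finset.subUset !finset.sub1set aS cc /= andbT.
  by apply/existsP; exists a; apply/existsP; exists c; rewrite ac /=.
case/orP => [/eqP ->|/andP[-> eS]].
  rewrite finset.subUset !finset.sub1set !inE uS eqxx orbT; split=> //.
  by apply/existsP; exists u; apply/existsP; exists v; rewrite uv /=.
by split=> //; apply: fintype.subset_trans eS _; apply: finset.subsetUr.
Qed.

End Step.

Lemma exists_step S : S != finset.set0 -> S != finset.setT ->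
  exists u v, [/\ u \in S, v \notin S & adj u v].
Proof.
case/finset.set0Pn => s sS ST.
have /existsP[u /existsP[v /and3P[? ? ?]]] : [exists u, exists v, [&& u \in S, v \notin S & adj u v]].
  apply: contraT => /existsPn no; case/negP: ST; apply/eqP/setP => t; rewrite inE.
  have /connectP[p pp ->] := adj_connected G s t.
  elim: p s sS pp => [|a p IH] s sS //= /andP[sa]; apply: IH.
  by have /existsPn/(_ a) := no s; rewrite sS sa andbT negbK.
by exists u, v.
Qed.

(** Summed against p, a nonempty low set counts for its vertices minus its edges. *)
Lemma low_sum_vertices_edges : in_shifted_interior x ->
  low_sum (fun I => I != finset.set0) =
  \sum_v low_sum (fun I => [set v] \subset I) - \sum_(e in edges G) low_sum (fun I => e \subset I).
Proof.
move=> hx.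
have grow n : (n < #|V|)%N -> exists S, [/\ #|S| = n.+1, conn S &
    low_sum (fun I => S :&: I != finset.set0) = \sum_(v in S) low_sum (fun I => [set v] \subset I)
    - \sum_(e in [set e in edges G | e \subset S]) low_sum (fun I => e \subset I)].
  elim: n => [/card_gt0P[v _]|n IH ltn].
    exists [set v]; split; first by rewrite cards1.
      by move=> a c; rewrite !inE => /eqP -> /eqP ->; apply: connect0.
    rewrite big_set1 big1 ?subr0 => [|e].
      apply: eq_low_sum => I; rewrite finset.sub1set; apply/finset.set0Pn/idP => [[a]|vI].
        by rewrite !inE => /andP[/eqP->].
      by exists v; rewrite !inE eqxx.
    rewrite inE => /andP[]; rewrite inE => /existsP[a /existsP[c /andP[ac /eqP->]]].
    rewrite finset.subUset !finset.sub1set !inE => /andP[/eqP E1 /eqP E2].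
    by move: ac; rewrite E1 E2 adj_irr.
  case: (IH (ltnW ltn)) => S [cardS cS ZS].
  have S0 : S != finset.set0 by rewrite -card_gt0 cardS.
  have ST : S != finset.setT.
    by apply: contraTneq ltn => E; rewrite -cardS E cardsT ltnn.
  case: (exists_step S0 ST) => u [v [uS vS uv]].
  exists (v |: S); split; first by rewrite cardsU1 vS cardS.
    exact: conn_step uS uv.
  rewrite (low_sum_step hx cS uS vS uv) ZS (edges_step cS uS vS uv).
  rewrite [in RHS]big_setU1 //= [in RHS]big_setU1 /=; last first.
    by rewrite !inE finset.subUset !finset.sub1set (negbTE vS) !andbF.
  by rewrite opprD; ring.
have V0 := vertex_nonempty G.
case: (grow #|V|.-1); first by rewrite prednK.
move=> S; rewrite prednK // => -[cardS _ ZS].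
have ST : S = finset.setT.
  by apply/eqP; rewrite eqEcard finset.subsetT cardsT cardS leqnn.
rewrite ST in ZS; rewrite (eq_low_sum (b' := fun I => finset.setT :&: I != finset.set0)).
  rewrite ZS; congr (_ - _); first by apply: eq_bigl => v; rewrite inE.
  by apply: eq_bigl => e; rewrite inE finset.subsetT andbT.
by move=> I; rewrite finset.setTI.
Qed.

End Growth.

(** * Taylor expansions as pairings *)

Section Expansion.
Variables (V : finType).
Implicit Types (y z : QL V) (S T : series V) (D E : gring (QL V)).

(** The total degree, by which bounded-below series are compared. *)
Definition deg y : rat := \sum_v y v.

Lemma degB y z : deg (y - z) = deg y - deg z.
Proof. by rewrite /deg -sumrB; apply: eq_bigr => v _; rewrite !ffunE. Qed.

Definition bounded_below S := exists N : rat, forall y, deg y < N -> S y = 0.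

Lemma puiseux_bounded S : puiseux S -> bounded_below S.
Proof.
case=> m [y0 [_ Sy]]; exists (deg y0) => y; apply: contraTeq => /Sy[_ y0y].
by rewrite -leNgt; apply: ler_sum.
Qed.

Lemma poly_actE D S y : poly_act D S y = lin D (fun z => S (y - z)).
Proof. by []. Qed.

Lemma poly_actM D E S : poly_act (D * E) S = poly_act D (poly_act E S).
Proof.
apply/funext => y; rewrite poly_actE linM; apply: eq_lin => a.
by rewrite poly_actE; apply: eq_lin => b; rewrite opprD addrA.
Qed.

Lemma poly_act1 S : poly_act 1 S = S.
Proof. by apply/funext => y; rewrite poly_actE lin1 subr0. Qed.

Lemma poly_act_Bmon a S y : poly_act (1 - t^[a]) S y = S y - S (y - a).
Proof. by rewrite poly_actE linBl lin1 lin_mon subr0. Qed.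

Lemma le_sum_seq (I : eqType) (s : seq I) (F : I -> rat) i :
  (forall i, 0 <= F i) -> i \in s -> F i <= \sum_(j <- s) F j.
Proof.
move=> F0 si; rewrite (big_rem i) //= lerDl; exact: sumr_ge0.
Qed.

Lemma bounded_below_act D S : bounded_below S -> bounded_below (poly_act D S).
Proof.
case=> N SN; exists (N - \sum_(z <- msupp D) `|deg z|) => y yN.
rewrite /poly_act big1_seq // => z /andP[_ zD]; rewrite SN ?mulr0 // degB.
have := le_sum_seq (F := fun z => `|deg z|) (fun z => normr_ge0 _) zD.
have := ler_norm (- deg z); rewrite normrN; lra.
Qed.

(** Denominators that determine expansions uniquely. *)
Definition act_inj D := forall S, bounded_below S ->
  poly_act D S = (fun=> 0) -> S = (fun=> 0).

Lemma act_inj1 : act_inj 1.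
Proof. by move=> S _; rewrite poly_act1. Qed.

Lemma act_injM D E : act_inj D -> act_inj E -> act_inj (D * E).
Proof.
move=> iD iE S bS; rewrite poly_actM => /iD E0; apply: iE => //.
exact/E0/bounded_below_act.
Qed.

(** A denominator with constant term 1 and other exponents of degree at least e > 0
    expresses S y through values of S at degree at most deg y - e. *)
Lemma act_inj_gmap (B : zmodType) (pi : B -> QL V) (D : gring B) (e : rat) :
  D@_0 = 1 -> pi 0 = 0 -> 0 < e ->
  (forall z : B, z \in msupp D -> z != 0 -> e <= deg (pi z)) -> act_inj (gmap pi D).
Proof.
move=> D0 pi0 e0 De S [N SN] act0.
have step n y : deg y < N + e *+ n -> S y = 0.
  elim: n y => [|n IH] y; first by rewrite addr0; apply: SN.
  move=> yn; have := congr1 (@^~ y) act0; rewrite poly_actE lin_gmap /lin /=.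
  have sD : 0 \in msupp D by rewrite -mcoeff_neq0 D0 oner_neq0.
  rewrite (big_rem 0) //= D0 mul1r pi0 subr0 big1_seq ?addr0 //.
  move=> z; rewrite (mem_rem_uniq _ (fset_uniq _)) inE => /andP[_ /andP[z0 zD]].
  by rewrite IH ?mulr0 // degB; have := De z zD z0; move: yn; rewrite mulrSr; lra.
apply/funext => y; pose n := Num.bound `|(deg y - N) / e|.
have : (deg y - N) / e < n%:R.
  exact: le_lt_trans (ler_norm _) (archi_boundP (normr_ge0 _)).
by rewrite ltr_pdivrMr // mulr_natl => ?; apply: (step n); lra.
Qed.

Lemma act_inj_mon a : 0 < deg a -> act_inj (1 - t^[a]).
Proof.
move=> a0 S [N SN] act0; apply/funext => y.
have step n : S y = S (y - a *+ n).
  elim: n => [|n ->]; first by rewrite subr0.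
  have := congr1 (@^~ (y - a *+ n)) act0; rewrite poly_act_Bmon => /eqP.
  by rewrite subr_eq0 mulrSr opprD addrA => /eqP.
pose n := Num.bound `|(deg y - N + 1) / deg a|.
have degMn m : deg (a *+ m) = deg a *+ m.
  by rewrite /deg -sumrMnl; apply: eq_bigr => v _; rewrite ffunMnE.
rewrite (step n) SN // degB degMn.
have : (deg y - N + 1) / deg a < n%:R.
  exact: le_lt_trans (ler_norm _) (archi_boundP (normr_ge0 _)).
by rewrite ltr_pdivrMr // mulr_natl; lra.
Qed.

Lemma Taylor_unique (f : gfrac (QL V)) S :
  act_inj (den f) -> is_taylor f S -> Taylor f = S.
Proof.
move=> inj TS; apply: xget_unique => // T [pT aT]; case: TS => pS aS.
have E : (fun y => T y - S y) = (fun=> 0).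
  apply: inj.
    case: (puiseux_bounded pS) (puiseux_bounded pT) => N SN [M TM].
    exists (Num.min N M) => y; rewrite lt_min => /andP[yN yM].
    by rewrite SN // TM // subrr.
  apply/funext => y; rewrite poly_actE linBr.
  have := congr1 (@^~ y) aT; have := congr1 (@^~ y) aS.
  by rewrite !poly_actE => -> ->; rewrite subrr.
by apply/funext => y; apply/eqP; rewrite -subr_eq0 (congr1 (@^~ y) E).
Qed.

End Expansion.

Section BigFrac.
Variables (A : zmodType) (I : finType) (P : pred I) (F : I -> gfrac A).

Lemma num_big : num (\big[@gfrac_mul A/@gfrac_one A]_(i | P i) F i) =
  \prod_(i | P i) num (F i).
Proof. exact: (big_morph (@num A)). Qed.

Lemma den_big : den (\big[@gfrac_mul A/@gfrac_one A]_(i | P i) F i) =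
  \prod_(i | P i) den (F i).
Proof. exact: (big_morph (@den A)). Qed.

End BigFrac.

Lemma num_exp (A : zmodType) (a : gring A) k : num (gfrac_exp a k) = a ^+ posz k.
Proof. by case: k. Qed.

Lemma den_exp (A : zmodType) (a : gring A) k : den (gfrac_exp a k) = a ^+ negz k.
Proof. by case: k. Qed.

Lemma gmap_Bmon (A B : zmodType) (pi : {additive A -> B}) (a : A) :
  gmap pi (1 - t^[a]) = 1 - t^[pi a].
Proof.
by apply: gring_eqP => f; rewrite lin_gmap !linBl !lin1 !lin_mon /= raddf0.
Qed.

Lemma gmap_prod_exp (A B : zmodType) (pi : {additive A -> B}) (I : finType)
    (F : I -> gring A) (F' : I -> gring B) (m m' : I -> nat) :
  (forall i, gmap pi (F i) = F' i) -> (forall i, m i = m' i) ->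
  gmap pi (\prod_i F i ^+ m i) = \prod_i F' i ^+ m' i.
Proof.
move=> FF' mm'; have g1 : gmap pi 1 = 1.
  by apply: gring_eqP => f; rewrite lin_gmap !lin1 /= raddf0.
rewrite (big_morph (gmap pi) (gmapM pi) g1); apply: eq_bigr => i _.
rewrite -mm' -FF'; elim: (m i) => [|n IH]; first by rewrite !expr0 g1.
by rewrite !exprS gmapM IH.
Qed.

(** * The coefficients of the counting function *)

Section Coefficients.
Variables (V : finType) (G : plumbing_tree V).
Local Notation Gam := (discr G * QL V)%type.
Implicit Types (v w : V) (psi : Gam -> int) (D : gring Gam) (l : dual G).

Lemma pairing_tact D psi : FF psi ->
  pairing (tact D psi) = lin D (fun z => pairing (fun g => psi (g + z))).
Proof.
move=> Fpsi; have [_ _ Fs] := FF_closed G.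
rewrite /lin /tact /lin pairing_sum => [|z]; last exact/FFZ/Fs.
by apply: eq_bigr => z _; rewrite pairingZ //; apply: Fs.
Qed.

Lemma pairing_neg psi : FF psi ->
  pairing (tact (dpow G (negexp (kappa G))) psi) = lin (dpow G (posexp (kappa G))) psi.
Proof.
move=> Fpsi; rewrite /pairing op_tact // (proj2 (opP _ Fpsi)) /tact.
by apply: eq_lin => z; rewrite add0r.
Qed.

Lemma num_fH : num (fH G) = dpow G (posexp (kappa G)).
Proof.
rewrite /fH num_big; apply: eq_bigr => v _.
by rewrite num_exp; congr (_ ^+ _); rewrite !ffunE.
Qed.

Lemma den_fH : den (fH G) = dpow G (negexp (kappa G)).
Proof.
rewrite /fH den_big; apply: eq_bigr => v _.
by rewrite den_exp; congr (_ ^+ _); rewrite !ffunE.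
Qed.

Lemma gmap_dfac v : gmap (@snd (discr G) (QL V)) (dfac G v) = 1 - t^[val (Estar G v)].
Proof. exact: (gmap_Bmon (@snd (discr G) (QL V))). Qed.

Lemma num_zeta : num (zeta G) = gmap (@snd (discr G) (QL V)) (dpow G (posexp (kappa G))).
Proof.
rewrite /zeta num_big; apply/esym.
under [RHS]eq_bigr do rewrite num_exp.
apply: gmap_prod_exp => v; first exact: gmap_dfac.
by rewrite !ffunE.
Qed.

Lemma den_zeta : den (zeta G) = gmap (@snd (discr G) (QL V)) (dpow G (negexp (kappa G))).
Proof.
rewrite /zeta den_big; apply/esym.
under [RHS]eq_bigr do rewrite den_exp.
apply: gmap_prod_exp => v; first exact: gmap_dfac.
by rewrite !ffunE.
Qed.

(** Any numerator of f_H over a denominator in the t_v alone computes pairings. *)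
Lemma pairing_num (F : gring Gam) (E : gring (QL V)) psi :
  gfrac_eq (fH G) (GFrac F (gmap (fun y => (0 : discr G, y)) E)) -> FF psi ->
  pairing (tact (gmap (fun y => (0 : discr G, y)) E) psi) = lin F psi.
Proof.
rewrite /gfrac_eq num_fH den_fH /=; move: (gmap _ E) => D eqF Fpsi.
have [sur _] := FF_bij_dpow G (negexp (kappa G)).
have [psi' Fpsi' psiE] := sur _ Fpsi.
rewrite /pairing (op_tact _ _ Fpsi).
have -> : op (kappa G) psi = tact (dpow G (posexp (kappa G))) psi'.
  apply/(op_char (m := negexp (kappa G)) (n := posexp (kappa G)) Fpsi).
  - exact: FF_tact.
  - by move=> v; rewrite !ffunE -posz_negz.
  by rewrite dpowC psiE.
rewrite -tactM [D * _]mulrC eqF tactM psiE /tact.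
by apply: eq_lin => z; rewrite add0r.
Qed.

Lemma Estar_den : exists2 m : nat, (0 < m)%N &
  forall g, cone g -> (g : Gam).2 *+ m \in inL.
Proof.
case: (common_den (fun vw : V * V => Estar G vw.1 vw.2)) => m m0 mE.
exists m => // g [n ->]; apply/forallP => w; rewrite ffunMnE.
rewrite (raddf_sum (@snd (discr G) (QL V))) sum_ffunE -sumrMnl rpred_sum // => v _.
by rewrite beta_snd -mulrnA mulnC mulrnA rpredMn // (mE (v, w)).
Qed.

Lemma cone_ge0 g v : cone (g : Gam) -> 0 <= g.2 v.
Proof.
case=> n ->; rewrite (raddf_sum (@snd (discr G) (QL V))) sum_ffunE sumr_ge0 // => w _.
by rewrite beta_snd mulrn_wge0 // ltW ?Estar_gt0.
Qed.

Lemma pairing_neq0 psi : FF psi -> pairing psi != 0 -> exists2 g, cone g & psi g != 0.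
Proof.
move=> Fpsi psi0; apply: contrapT => no; case/eqP: psi0.
rewrite -[RHS](pairing0 G); apply: pairing_ext => //; first exact: FF0.
by move=> g gc; apply/eqP/negPn/negP => gn; apply: no; exists g.
Qed.

(** The indicator of the exponents l' = y. *)
Definition eps (y : QL V) : Gam -> int := fun g => (g.2 == y)%:R.

Lemma FF_eps y : FF (eps y).
Proof.
exists (\sum_v `|y v| + 1) => g gN; rewrite /eps; case: eqP => // yE.
case: (card_gt0P (vertex_nonempty G)) => v _.
have := gN v; rewrite yE leNgt (bigD1 v) //= => /negP[].
have := ler_norm (y v); have : 0 <= \sum_(i | i != v) `|y i| by apply: sumr_ge0.
by lra.
Qed.

(** The coefficient of t^y in the expansion of [zeta] is the pairing with the indicator of
    the exponent y. *)
Lemma zeta_taylor : is_taylor (zeta G) (fun y => pairing (eps y)).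
Proof.
split.
  case: Estar_den => m m0 mL; exists m, 0; split=> // y yn.
  case: (pairing_neq0 (FF_eps y) yn) => g gc; rewrite /eps.
  case: (g.2 =P y) => [<- _|_]; last by rewrite eqxx.
  split; first exact: mL.
  by move=> v; rewrite ffunE cone_ge0.
apply/funext => y; rewrite poly_actE den_zeta lin_gmap.
under eq_lin => z do rewrite /=.
have -> : lin (dpow G (negexp (kappa G))) (fun z => pairing (eps (y - z.2))) =
    lin (dpow G (negexp (kappa G))) (fun z => pairing (fun g => eps y (g + z))).
  by apply: eq_lin => z; congr pairing; apply/funext => g; rewrite /eps /= eq_sym subr_eq eq_sym.
rewrite -(pairing_tact _ (FF_eps y)) (pairing_neg (FF_eps y)).
by rewrite -lin_coef num_zeta lin_gmap; apply: eq_lin.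
Qed.

Lemma deg_Estar v : 0 < deg (val (Estar G v)).
Proof.
rewrite /deg (bigD1 v) //= ltr_wpDr ?Estar_gt0 // sumr_ge0 // => w _.
by rewrite ltW ?Estar_gt0.
Qed.

Lemma p_E l : p_ l = pairing (eps (val l)).
Proof.
rewrite /p_ /Coeff (Taylor_unique _ zeta_taylor) // /zeta den_big.
apply: (big_ind (@act_inj V)); [exact: act_inj1|exact: act_injM|move=> v _].
rewrite den_exp; elim: (negz _) => [|n IH]; first by rewrite expr0; apply: act_inj1.
by rewrite exprS; apply: act_injM IH; apply: act_inj_mon; apply: deg_Estar.
Qed.

Section Counting.
Variables (h : discr G) (x : dual G).

Lemma cone_iota g : cone g -> exists l, g = iota l.
Proof.
case=> n ->; exists (\sum_v Estar G v *+ n v).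
by rewrite raddf_sum; apply: eq_bigr => v _; apply/esym; apply: raddfMn.
Qed.

(** Only finitely many exponents of the expansion have a coordinate smaller than that
    of [x]. *)
Lemma low_finite : exists s : seq (dual G), uniq s /\
  forall l, cone (iota l) -> low x (iota l) != finset.set0 -> l \in s.
Proof.
pose N := \sum_v `|x v|.
have /choice[M MP] v := beta_large (0 : Gam) v N.
pose K := (\max_v M v).+1.
exists (undup [seq \sum_v Estar G v *+ (f : {ffun V -> 'I_K}) v | f : {ffun V -> 'I_K}]).
split; first exact: undup_uniq.
move=> l [n lE] /finset.set0Pn[w]; rewrite inE => lw; rewrite mem_undup.
have nK v : (n v < K)%N.
  rewrite ltnS leqNgt; apply/negP => Kn.
  have /(MP v)/(_ w) : (M v <= n v)%N.
    by apply: leq_trans (ltnW Kn); exact: (leq_bigmax (F := M) v).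
  rewrite add0r beta_snd => Nle; move: lw; rewrite ltNge => /negP[].
  have xN : x w <= N by apply: le_trans (ler_norm _) _; rewrite /N (bigD1 w) //= lerDl sumr_ge0.
  apply: le_trans xN (le_trans Nle _).
  rewrite lE (raddf_sum (@snd (discr G) (QL V))) sum_ffunE (bigD1 v) //= beta_snd lerDl.
  by apply: sumr_ge0 => u _; rewrite beta_snd mulrn_wge0 // ltW ?Estar_gt0.
apply/mapP; exists [ffun v => Ordinal (nK v)]; first by rewrite mem_enum.
apply: val_inj.
rewrite -[val l]/(iota l).2 lE (raddf_sum (@snd (discr G) (QL V))) raddf_sum.
apply: eq_bigr => v _; rewrite ffunE /=.
apply/ffunP => u; rewrite [LHS]beta_snd -[dual_val (_ *+ _)]/(val (Estar G v *+ n v)).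
by rewrite raddfMn ffunMnE.
Qed.

Lemma Q_E : Q_ h x = low_sum h x (fun I => I != finset.set0).
Proof.
case: low_finite => s [us sP].
pose b (l : dual G) := (cls l == h) && (low x (iota l) != finset.set0).
have bE l : b l <-> (~ (forall v, x v <= l v) /\ cls l = h).
  split=> [/andP[/eqP lh /finset.set0Pn[v]]|[nle lh]].
    by rewrite inE => lv; split=> // /(_ v); rewrite leNgt lv.
  rewrite /b lh eqxx; apply/finset.set0Pn; apply: contrapT => no; apply: nle => v.
  by rewrite leNgt; apply/negP => lv; apply: no; exists v; rewrite inE.
have p0 l : p_ l != 0 -> cone (iota l).
  rewrite p_E => /(pairing_neq0 (FF_eps _))[g gc]; rewrite /eps.
  case: (g.2 =P _) => [gl _|_]; last by rewrite eqxx.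
  have [l' gE] := cone_iota gc; rewrite gE in gl gc.
  by have <- : l' = l by apply: val_inj.
rewrite /Q_ (fsbigE [seq l <- s | b l]).
- have -> : low_sum h x (fun I => I != finset.set0) =
      pairing (fun g => \sum_(l <- s) (b l)%:R * eps (val l) g).
    apply: pairing_ext.
    + by apply: FF_low_fun; rewrite eqxx.
    + by apply: FF_sum => l; apply/FFZ/FF_eps.
    move=> g gc; case: (cone_iota gc) => l gl; rewrite gl in gc *.
    rewrite /low_fun -/(b l).
    have epsE l' : eps (val l') (iota l) = (l' == l)%:R by rewrite /eps /= eq_sym -val_eqE.
    under eq_bigr do rewrite epsE.
    case: (boolP (l \in s)) => ls.
      rewrite (bigD1_seq l) //= eqxx mulr1 big1 ?addr0 // => l' /negbTE ->.
      by rewrite mulr0.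
    have -> : b l = false.
      by apply/negP => /andP[_ ll]; rewrite (sP l gc ll) in ls.
    rewrite big1_seq // => l' /andP[_ l's].
    by case: eqP => [E|_]; rewrite ?mulr0 //; rewrite -E l's in ls.
  rewrite pairing_sum => [|l]; last exact/FFZ/FF_eps.
  rewrite big_filter_cond big_mkcond; apply: eq_bigr => l _.
  rewrite (pairingZ _ (FF_eps _)) p_E; case: ifP => [/andP[-> _]|/negbT]; first by rewrite mul1r.
  case: (boolP (b l)) => [bl|_ _]; last by rewrite mul0r.
  by rewrite andTb => /negP[]; apply: mem_set; apply/bE.
- by rewrite filter_uniq.
- by move=> l /=; rewrite mem_filter => /andP[/bE].
move=> l /bE bl ln; apply/eqP/negPn/negP => /p0 lc; case/negP: ln.
by rewrite mem_filter bl sP //; case/andP: bl.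
Qed.

End Counting.

End Coefficients.

(** * The coefficients of the twisted fractions *)

Section Twisted.
Variables (V : finType) (G : plumbing_tree V).
Local Notation Gam := (discr G * QL V)%type.
Variables (h : discr G) (r : dual G) (I : {set V}).
Implicit Types (y : QL V) (v : V) (J : {set V}) (k : Gam).

(** The exponents of t / (1 - t). *)
Definition posint (q : rat) : int := ((q \is a Num.int) && (0 < q))%:R.

Lemma posint_sub q : posint q - posint (q - 1) = (q == 1)%:R.
Proof.
rewrite /posint rpredBr ?rpred1 //; case: (boolP (q \is a Num.int)) => /=; last first.
  by move=> qn; case: eqP => // q1; rewrite q1 rpred1 in qn.
case/intrP => n ->; have -> : (n%:~R - 1 : rat) = (n - 1)%:~R by rewrite intrB.
rewrite !ltr0z (eqr_int rat n 1).
by case: n => [[|[|n]]|n].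
Qed.

(** The coefficient of t^y in the product of t_I^(-r) t_I^(k.2) by the t_v / (1 - t_v),
    v in [I], when [k] has class [h]; the factors 1 - t_v with v in [J] are removed from
    the denominator. *)
Definition twist_partial J y k : int :=
  ((k.1 == h) && [forall v, (v \notin I) ==> (y v == 0)])%:R *
  \prod_(v in I) (if v \in J then (y v + r v - k.2 v == 1)%:R
                  else posint (y v + r v - k.2 v)).

(** The function on exponents [k] whose pairing is the coefficient of t^y in the
    expansion of the twisted fraction. *)
Definition twist_fun := twist_partial finset.set0.

Lemma twist_partial_step J v y k : v \in I -> v \notin J ->
  twist_partial J y k - twist_partial J (y - Evec v) k = twist_partial (v |: J) y k.
Proof.
move=> vI vJ; rewrite /twist_partial.
have -> : [forall w, (w \notin I) ==> ((y - Evec v) w == 0)] =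
          [forall w, (w \notin I) ==> (y w == 0)].
  apply: eq_forallb => w; case: (boolP (w \in I)) => //= wI.
  rewrite !ffunE; case: (v =P w) => [E|_]; last by rewrite subr0.
  by rewrite -E vI in wI.
rewrite -mulrBr; congr (_ * _).
rewrite (bigD1 v) //= [X in _ - X](bigD1 v) //= [RHS](bigD1 v) //=.
rewrite (negbTE vJ) !inE eqxx /= !ffunE eqxx.
have -> : \prod_(w in I | w != v) (if w \in J then ((y - Evec v) w + r w - k.2 w == 1)%:R
      else posint ((y - Evec v) w + r w - k.2 w)) =
    \prod_(w in I | w != v) (if w \in J then (y w + r w - k.2 w == 1)%:R
      else posint (y w + r w - k.2 w)) :> int.
  apply: eq_bigr => w /andP[_ wv]; rewrite !ffunE.
  by rewrite [v == w]eq_sym (negbTE wv) subr0.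
rewrite -mulrBl -posint_sub; congr ((_ - posint _) * _); first by rewrite mulr1n; ring.
by apply: eq_bigr => w /andP[_ wv]; rewrite !inE (negbTE wv).
Qed.

Lemma twist_partial_full y k : twist_partial I y k =
  ((k.1 == h) && (restr I (- val r) + restr I k.2 + \sum_(v in I) Evec v == y))%:R.
Proof.
have natb (a b : bool) : (a && b)%:R = a%:R * b%:R :> int by case: a; case: b.
rewrite /twist_partial !natb -mulrA; congr (_ * _).
have sE w : (\sum_(v in I) Evec v) w = (w \in I)%:R.
  rewrite sum_ffunE big_mkcond (bigD1 w) //= ffunE eqxx big1 ?addr0; first by case: (w \in I).
  by move=> v vw; rewrite ffunE (negbTE vw) if_same.
pose one v := y v + r v - k.2 v == 1.
have -> : \prod_(v in I) (if v \in I then (one v)%:R else posint (y v + r v - k.2 v)) =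
    [forall v in I, one v]%:R.
  case: (boolP [forall v in I, one v]) => [/forall_inP all1|].
    by rewrite big1 // => v vI; rewrite vI all1.
  case/forall_inPn => v vI vn; apply/eqP; rewrite (bigD1 v) //= vI.
  by rewrite (negbTE vn) mul0r.
rewrite -natb; congr (nat_of_bool _)%:R; apply/idP/eqP.
  move=> /andP[/forallP y0 /forall_inP y1]; apply/ffunP => w; rewrite !ffunE sE.
  case: (boolP (w \in I)) => wI; first by rewrite mulr1n; have /eqP := y1 w wI; lra.
  by have := y0 w; rewrite wI => /eqP ->; rewrite !addr0.
move=> E; apply/andP; split.
  by apply/forallP => w; apply/implyP => wI; rewrite -E !ffunE sE (negbTE wI) !addr0.
by apply/forall_inP => w wI; rewrite /one -E !ffunE sE wI mulr1n; apply/eqP; ring.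
Qed.

Lemma poly_act_twist_fun k :
  poly_act (\prod_(v in I) (1 - t^[Evec v])) (twist_fun^~ k) = twist_partial I ^~ k.
Proof.
have step (s : seq V) J : uniq s -> {subset s <= I} -> (forall v, v \in s -> v \notin J) ->
    poly_act (\prod_(v <- s) (1 - t^[Evec v])) (twist_partial J ^~ k) =
    twist_partial ([set v in s] :|: J) ^~ k.
  elim: s J => [|v s IH] J.
    have E : [set v in [::]] :|: J = J by apply/setP => w; rewrite !inE.
    by rewrite big_nil poly_act1 E.
  move=> /andP[vs us] sI sJ; rewrite big_cons [X in poly_act X]mulrC poly_actM.
  have -> : poly_act (1 - t^[Evec v]) (twist_partial J ^~ k) = twist_partial (v |: J) ^~ k.
    apply/funext => y; rewrite poly_act_Bmon twist_partial_step //.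
      by apply: sI; rewrite mem_head.
    by apply: sJ; rewrite mem_head.
  rewrite IH // => [|w ws|w ws].
  - have -> : [set w in v :: s] :|: J = [set w in s] :|: (v |: J) => //.
    by apply/setP => w; rewrite !inE orbCA orbA.
  - by apply: sI; rewrite inE ws orbT.
  rewrite !inE negb_or sJ ?inE ?ws ?orbT // andbT.
  by apply: contraNneq vs => <-.
rewrite -big_enum /= /twist_fun step ?enum_uniq //.
- have -> : [set v in enum I] :|: finset.set0 = I => //.
  by apply/setP => v; rewrite !inE mem_enum orbF.
- by move=> v; rewrite mem_enum.
- by move=> v _; rewrite inE.
Qed.

Hypothesis I0 : I != finset.set0.

Lemma FF_twist_fun y : FF (twist_fun y).
Proof.
case/finset.set0Pn: I0 => v vI; exists (y v + r v) => g gN.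
rewrite /twist_fun /twist_partial (bigD1 v) //= inE /posint.
have -> : (0 < y v + r v - g.2 v) = false.
  by apply/negbTE; rewrite -leNgt subr_le0 gN.
by rewrite andbF mul0r mulr0.
Qed.

Lemma twist_fun_shift y z k : twist_fun (y - restr I z) k = twist_fun y (k + (0, z)).
Proof.
rewrite /twist_fun /twist_partial /= addr0; congr ((nat_of_bool (_ && _))%:R * _).
  apply: eq_forallb => v; case: (boolP (v \in I)) => //= vI.
  by rewrite !ffunE (negbTE vI) subr0.
apply: eq_bigr => v vI; rewrite !inE !ffunE vI; congr posint.
by ring.
Qed.

Lemma twist_fun_neq0 y k : twist_fun y k != 0 -> [/\ k.1 = h, (forall v, v \notin I -> y v = 0) &
  forall v, v \in I -> (y v + r v - k.2 v \is a Num.int) /\ 0 < y v + r v - k.2 v].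
Proof.
rewrite /twist_fun /twist_partial mulf_eq0 negb_or => /andP[].
case: (k.1 =P h) => [kh|_]; last by rewrite eqxx.
case: (boolP [forall v, _]) => [/forallP y0 _|_]; last by rewrite eqxx.
move=> pr; split=> // v vI; first by have := y0 v; rewrite vI => /eqP.
move: pr; rewrite (bigD1 v) //= inE mulf_eq0 negb_or => /andP[+ _].
by rewrite /posint; case: (boolP (_ && _)) => // /andP[].
Qed.

Variables (f : discr G -> gfrac (QL V)) (hf : components f).

Lemma twist_fun_puiseux : puiseux (fun y => pairing (twist_fun y)).
Proof.
case: (Estar_den G) => m m0 mL; case: (common_den (val r)) => n n0 nr.
exists (m * n)%N, (restr I (- val r)); rewrite muln_gt0 m0 n0; split=> // y yn.
case: (pairing_neq0 (FF_twist_fun y) yn) => k kc /twist_fun_neq0[_ y0 y1].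
split.
  apply/forallP => v; rewrite ffunMnE.
  case: (boolP (v \in I)) => [/y1[yint _]|/y0 ->]; last by rewrite mul0rn rpred0.
  have -> : y v = (y v + r v - k.2 v) + k.2 v - r v by ring.
  rewrite mulrnBl mulrnDl; apply: rpredB; first apply: rpredD.
  - exact: rpredMn.
  - by rewrite mulrnA rpredMn //; have /forallP/(_ v) := mL k kc; rewrite ffunMnE.
  - by rewrite mulnC mulrnA rpredMn // nr.
move=> v; rewrite !ffunE; case: (boolP (v \in I)) => [/y1[_]|/y0 -> //].
by have := cone_ge0 v kc; lra.
Qed.

Lemma prod_gmon : \prod_(v in I) t^[Evec v] = t^[\sum_(v in I) Evec v] :> gring (QL V).
Proof. by rewrite (big_morph (@gmon (QL V)) (@gmonD (QL V)) (erefl : t^[0] = 1)). Qed.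

Lemma twisted_taylor : is_taylor (twisted I r (f h)) (fun y => pairing (twist_fun y)).
Proof.
split; first exact: twist_fun_puiseux.
case: hf => F [D [_ eqF ->]]; rewrite /twisted /gfrac_mul /= num_big den_big /=.
rewrite mul1r [X in poly_act X]mulrC poly_actM.
have -> : poly_act (gmap (restr I) D) (fun y => pairing (twist_fun y)) =
    (fun y => lin F (twist_fun y)).
  apply/funext => y; rewrite poly_actE lin_gmap -(pairing_num eqF (FF_twist_fun y)).
  rewrite pairing_tact; last exact: FF_twist_fun.
  rewrite lin_gmap; apply: eq_lin => z /=; congr pairing; apply/funext => k.
  exact: twist_fun_shift.
apply/funext => y; rewrite poly_actE (lin_exchange _ _ (fun z => twist_fun (y - z))).
rewrite -lin_coef linM linM lin_mon lin_gmap lin_hcomp.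
apply: eq_lin => k; have := congr1 (@^~ y) (poly_act_twist_fun k).
rewrite poly_actE twist_partial_full /= => ->; rewrite prod_gmon lin_mon.
by case: (k.1 == h); rewrite ?mul1r ?mul0r.
Qed.

Lemma twisted_inj : act_inj (den (twisted I r (f h))).
Proof.
case: hf => F [D [[D0 Dpos] _ ->]]; rewrite /twisted /gfrac_mul /= den_big /= mul1r.
case/finset.set0Pn: I0 => v vI.
have degI (z : QL V) : (forall v, 0 < z v) -> 0 < deg (restr I z).
  move=> zp; rewrite /deg (bigD1 v) //= ffunE vI ltr_wpDr // sumr_ge0 // => w _.
  by rewrite ffunE; case: ifP => // _; apply: ltW.
apply: act_injM.
  pose e := \big[Num.min/1]_(z <- msupp D | z != 0) deg (restr I z).
  apply: (act_inj_gmap (e := e)) => //.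
  - by apply/ffunP => w; rewrite !ffunE if_same.
  - rewrite /e big_seq_cond; apply: (big_ind (fun q : rat => 0 < q)) => // [a b a0 b0|z /andP[zD z0]].
      by rewrite lt_min a0.
    exact/degI/Dpos.
  - move=> z zD z0; rewrite /e.
    have {}zD : z \in (enum_fset (msupp D)) by [].
    elim: (enum_fset _) zD => // a s IH; rewrite inE big_cons => /predU1P[<-|zs].
      by rewrite z0 ge_min lexx.
    by case: ifP => _; rewrite ?ge_min IH ?orbT.
apply: (big_ind (@act_inj V)); [exact: act_inj1|exact: act_injM|move=> w _].
apply: act_inj_mon; rewrite /deg (bigD1 w) //= ffunE eqxx ltr_wpDr // sumr_ge0 // => u _.
by rewrite ffunE; case: eqP.
Qed.

Lemma Coeff_twisted y : Coeff (Taylor (twisted I r (f h))) y = pairing (twist_fun y).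
Proof. by rewrite /Coeff (Taylor_unique twisted_inj twisted_taylor). Qed.

End Twisted.

(** [r_ g] is the representative of [g] with coordinates in [0, 1): subtract the integral
    parts from any representative. *)
Lemma r_P (V : finType) (G : plumbing_tree V) (g : discr G) :
  cls (r_ g) = g /\ forall v, 0 <= r_ g v < 1.
Proof.
suff [y yP] : exists y : dual G, cls y = g /\ forall v, 0 <= y v < 1.
  exact: (xgetPex (P := [set y : dual G | _]%classic) 0 (ex_intro _ y yP)).
pose x : dual G := repr g.
have xg : cls x = g by rewrite /cls reprK.
pose n : QL V := [ffun v => (Num.floor (x v))%:~R].
have nD : n \in in_dual G.
  apply/forallP => w; rewrite form_Evec rpredD // ?rpredM // ?ffunE ?intr_int //.
  by rewrite rpred_sum // => i _; rewrite ffunE intr_int.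
exists (x - Dual nD); split.
  rewrite -xg; apply/eqP; rewrite cls_eq; apply/forallP => v.
  have -> : val (x - Dual nD - x) = - n by rewrite addrAC subrr add0r raddfN.
  by rewrite !ffunE rpredN intr_int.
move=> v; have -> : (x - Dual nD : dual G) v = x v - n v.
  by rewrite -[dual_val _]/(val _) raddfB !ffunE.
rewrite ffunE; have /andP[xge xlt] := floor_itv (x v); rewrite intrD in xlt.
by apply/andP; split; lra.
Qed.

(** As x + r - l is integral for [l] of class [h] and 0 <= r_v < 1, the condition
    x_v + r_v - l_v > 0 is equivalent to l_v < x_v. *)
Lemma Coeff_twisted_low_sum (V : finType) (G : plumbing_tree V) (f : discr G -> gfrac (QL V))
    (h : discr G) (x : dual G) (I : {set V}) : components f -> I != finset.set0 ->
  Coeff (Taylor (twisted I (r_ (h - cls x)) (f h))) (restr I x) =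
  low_sum h x (fun J => I \subset J).
Proof.
move=> hf I0; rewrite Coeff_twisted //; apply: pairing_ext.
- exact: FF_twist_fun.
- apply: FF_low_fun; apply/negbTE; apply: contraNN I0 => /fintype.subsetP I0.
  by apply/eqP/setP => v; rewrite [RHS]inE; apply/negP => /I0; rewrite inE.
move=> g gc; case: (cone_iota gc) => l ->; rewrite /low_fun /twist_fun /twist_partial /=.
case: (r_P (h - cls x)) => rc r01; set r := r_ _ in rc r01 *.
case: (cls l =P h) => [lh|_]; last by rewrite mul0r.
have -> : [forall v, (v \notin I) ==> (restr I x v == 0)].
  by apply/forallP => v; apply/implyP => vI; rewrite ffunE (negbTE vI).
rewrite mul1r /=.
have xrl v : x v + r v - l v \is a Num.int.
  have : val (x + r - l) \in inL.
    by rewrite -cls_eq clsD rc lh addrC subrK.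
  by move=> /forallP/(_ v); rewrite raddfB raddfD !ffunE.
have pE v : v \in I -> posint (restr I x v + r v - l v) = (l v < x v)%R%:R.
  move=> vI; rewrite ffunE vI /posint xrl /=; congr (nat_of_bool _)%:R.
  have := xrl v; have /andP[r0 r1] := r01 v => /intrP[n nE].
  apply/idP/idP; last by lra.
  rewrite nE ltr0z => n0; have : 1 <= n%:~R :> rat by rewrite -[1]/(1%:~R) ler_int.
  by lra.
case: (boolP (I \subset _)) => [/fintype.subsetP Il|/subsetPn[v vI vl]].
  by rewrite big1 // => v vI; rewrite inE pE //; have := Il v vI; rewrite inE => ->.
rewrite (bigD1 v) //= inE pE //; move: vl; rewrite inE => /negbTE ->.
by rewrite mul0r.
Qed.

Theorem theorem17 (V : finType) (G : plumbing_tree V)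
    (f : discr G -> gfrac (QL V)) (hf : components f)
    (h : discr G) (x : dual G) (hx : in_shifted_interior x) :
  Q_ h x =
    \sum_(v : V)
      Coeff (Taylor (twisted [set v] (r_ (h - cls x)) (f h)))
            (restr [set v] x)
    - \sum_(I in edges G)
      Coeff (Taylor (twisted I (r_ (h - cls x)) (f h)))
            (restr I x).
Proof.
rewrite Q_E (low_sum_vertices_edges h hx); congr (_ - _).
  apply: eq_bigr => v _; rewrite Coeff_twisted_low_sum //.
  by apply/finset.set0Pn; exists v; rewrite inE.
apply: eq_bigr => I; rewrite inE => /existsP[v /existsP[w /andP[_ /eqP ->]]].
rewrite Coeff_twisted_low_sum //.
by apply/finset.set0Pn; exists v; rewrite !inE eqxx.
Qed.
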